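(* Let $X$ be a four dimensional real vector space with a Euclidean structure and an orthonormal basis $e_1,e_2,e_3,e_4$, and let $$\mathcal C=\Bigl\{\sum_{i=1}^4 y_ie_i\in X : \Bigl|\tfrac{y_1+y_3}{\sqrt2}\Bigr|+\Bigl|\tfrac{y_2-y_4}{\sqrt2}\Bigr|+\Bigl|\tfrac{y_1-y_2-y_3-y_4}{2}\Bigr|+\Bigl|\tfrac{y_1+y_2-y_3+y_4}{2}\Bigr|\le 1\Bigr\}.$$ Let $n>4$ be a natural number, let $B_2^{n-4}$ be the Euclidean unit ball of $\mathbb R^{n-4}$, and let $Y=X\times\mathbb R^{n-4}$ be the $n$ dimensional normed vector space whose norm $|\cdot|_Y$ is the Minkowski functional of $\mathcal C\times B_2^{n-4}$. Then in $Y$ there is no linear contraction of the Hausdorff measure $\mathcal H^2_{|\cdot|_Y}$ (the two dimensional Hausdorff measure induced by the norm $|\cdot|_Y$) onto the two dimensional plane $\mathrm{span}(e_1,e_2)$, where $X$ is identified with $X\times\{0\}\subset Y$.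
   Context: $Y$ carries the product Euclidean structure. A linear contraction of $\mathcal H^2_{|\cdot|_Y}$ onto a two dimensional linear subspace $W\subset Y$ is a linear projection $\Pi:Y\to Y$ with range $W$ (that is, $\Pi\circ\Pi=\Pi$ and $\Pi(Y)=W$) such that $\mathcal H^2_{|\cdot|_Y}(\Pi(A))\le\mathcal H^2_{|\cdot|_Y}(A)$ for every two dimensional linear subspace $V\subset Y$ and every two dimensional Euclidean disc $A\subset V$. *)

(* Defs.v *)
From HB Require Import structures.
From mathcomp Require Import all_boot all_order all_algebra.
From mathcomp Require Import all_classical all_reals all_analysis.

Set Implicit Arguments.
Unset Strict Implicit.
Unset Printing Implicit Defensive.

Import Order.TTheory GRing.Theory Num.Theory.

Local Open Scope classical_set_scope.
Local Open Scope ring_scope.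

Definition minkowski_functional (R : realType) (E : lmodType R) (K : set E)
    (v : E) : R :=
  inf [set t : R | 0 < t /\ exists2 k, K k & v = t *: k].

Section Hausdorff.
Variables (R : realType) (E : lmodType R) (N : E -> R).

(* The point 0 is added so that the diameter of the empty set is 0. *)
Definition diameter (A : set E) : \bar R :=
  ereal_sup ([set 0%E] `|` [set (N (x - y))%:E | x in A & y in A]).

(* The factor pi / 4 makes the unit ball of a normed plane have measure pi. *)
Definition hausdorff2_pre (delta : R) (A : set E) : \bar R :=
  ereal_inf [set s : \bar R | exists F : nat -> set E,
    [/\ A `<=` \bigcup_i F i,
        forall i, (diameter (F i) <= delta%:E)%E &
        s = (\sum_(0 <= i <oo) ((pi / 4)%:E * diameter (F i) ^+ 2))%E]].

(* The supremum is the limit as delta tends to 0 from above, because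
   [hausdorff2_pre] is nonincreasing in delta. *)
Definition hausdorff2 (A : set E) : \bar R :=
  ereal_sup [set hausdorff2_pre delta A | delta in [set d : R | 0 < d]].

End Hausdorff.

Section Contraction.
Variables (R : realType) (E : vectType R).

(* [eucl] is a Euclidean norm on E. *)
Definition euclidean_disc (eucl : E -> R) (V : {vspace E}) (A : set E) : Prop :=
  exists (c : E) (r : R), [/\ c \in V, 0 < r &
    A = [set v | v \in V /\ eucl (v - c) <= r]].

Definition hausdorff2_contraction (eucl N : E -> R) (W : {vspace E})
    (Pi : 'End(E)) : Prop :=
  [/\ (Pi \o Pi)%VF = Pi,
      limg Pi = W &
      forall V : {vspace E}, \dim V = 2%N ->
      forall A : set E, euclidean_disc eucl V A ->
        (hausdorff2 N (Pi @` A) <= hausdorff2 N A)%E].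

End Contraction.

Section NormedSpace.
Variables (R : realType) (X : vectType R) (dot : {dot X for idfun}).
Variables (e : 4.-tuple X) (n : nat).

Definition bodyC : set X := [set x |
  let y1 := coord e (inord 0) x in
  let y2 := coord e (inord 1) x in
  let y3 := coord e (inord 2) x in
  let y4 := coord e (inord 3) x in
  `|(y1 + y3) / Num.sqrt 2| + `|(y2 - y4) / Num.sqrt 2|
  + `|(y1 - y2 - y3 - y4) / 2| + `|(y1 + y2 - y3 + y4) / 2| <= 1].

Definition eucl_norm (m : nat) (z : 'rV[R]_m) : R :=
  Num.sqrt (\sum_(i < m) z 0 i ^+ 2).

Definition eucl_unit_ball (m : nat) : set 'rV[R]_m :=
  [set z | eucl_norm z <= 1].

Definition spaceY : vectType R := (X * 'rV[R]_(n - 4))%type.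

Definition normY : spaceY -> R :=
  minkowski_functional (bodyC `*` @eucl_unit_ball (n - 4)).

Definition euclY (v : spaceY) : R :=
  Num.sqrt (dot v.1 v.1 + eucl_norm v.2 ^+ 2).

Definition planeW : {vspace spaceY} :=
  <<[:: (tnth e (inord 0), 0%R); (tnth e (inord 1), 0%R)]>>%VS.

End NormedSpace.

Arguments normY {R X} e n v.
Arguments euclY {R X} dot n v.
Arguments planeW {R X} e n.

(* Main.v *)
(** The body [C] is the unit ball of [l1^4] in the orthonormal coordinates
    [u1 = (e1 + e3)/rt2], [u2 = (e2 - e4)/rt2], [u3 = (e1 - e2 - e3 - e4)/2],
    [u4 = (e1 + e2 - e3 + e4)/2]. In a plane of a normed space the Hausdorff
    measure is Lebesgue measure divided by the area of the unit disc of the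
    norm (times [pi]), so a linear contraction [Pi] onto [W = span(e1, e2)]
    satisfies [|det(Pi | V)| * area(B cap V) <= area(B cap W) =: 2 c] for every
    plane [V], where [c = 6 rt2 - 8]. We use planes of two kinds only: those
    where [B cap V] is a square or a centrally symmetric hexagon, so that discs
    of [V] are covered efficiently by translates of [B cap V]. The unit disc
    of [W] is a regular octagon, for which the isodiametric inequality follows
    by slicing. With [b1 = u1], [b2 = u4], [b3 = u2], [b4 = - u3] and
    [w_ij = det (Pi b_i, Pi b_j)], one gets

      - [w_ij <= c] from [span(b_i, b_j)];
      - [w_ij + w_jk + w_ik <= 8 c / 3] from [span(b_i + b_j, b_j + b_k)], where
        [(i, j, k)] are consecutive in the cyclic order [b1, b2, b3, b4, - b1];
      - [(rt2/4)(w12 + w23 + w34 + w14) + (w13 + w24)/2 = 1], as [Pi] is the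
        identity on [W];
      - the Pluecker relation [w12 w34 - w13 w24 + w14 w23 = 0].

    The first, third and fourth force [w13 = w24 = c] and two cyclically adjacent
    values among [w12, w23, w34, w14] to be [c], against the second. *)

Require Import Defs.
From HB Require Import structures.
From mathcomp Require Import all_boot all_order all_algebra.
From mathcomp Require Import all_classical all_reals all_analysis.
From mathcomp Require Import measurable_realfun ring lra zify.

Set Implicit Arguments.
Unset Strict Implicit.
Unset Printing Implicit Defensive.


Import Order.TTheory GRing.Theory Num.Theory.
Import numFieldNormedType.Exports.

Local Open Scope classical_set_scope.
Local Open Scope ring_scope.

(** * Area in the plane and linear changes of variables *)

Section PlaneMeasure.
Variable R : realType.
Local Notation mu := (@lebesgue_measure R).
Local Notation RR := (measurableTypeR R * measurableTypeR R)%type.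

Definition area : {measure set RR -> \bar R} := (mu \x mu)%E.

Lemma xsection_set (S : set RR) x : xsection S x = [set y | S (x, y)].
Proof. by apply/seteqP; split => y; rewrite /xsection /= inE. Qed.

Lemma ysection_set (S : set RR) y : ysection S y = [set x | S (x, y)].
Proof. by apply/seteqP; split => x; rewrite /ysection /= inE. Qed.

Lemma area_xsection (S : set RR) :
  area S = (\int[mu]_x mu [set y | S (x, y)])%E.
Proof. by apply: eq_integral => x _ /=; rewrite xsection_set. Qed.

Lemma area_ysection (S : set RR) : measurable S ->
  area S = (\int[mu]_y mu [set x | S (x, y)])%E.
Proof.
move=> mS; have := indic_fubini_tonelli mu mu mS.
rewrite indic_fubini_tonelli_FE // indic_fubini_tonelli_GE // => e.
by rewrite [LHS]e; apply: eq_integral => y _ /=; rewrite ysection_set.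
Qed.

Lemma measurable_affine (a b : R) : measurable_fun setT
  (fun x : measurableTypeR R => a * x + b : measurableTypeR R).
Proof. by apply: measurable_funD => //; apply: measurable_funM. Qed.

(** Uniqueness of Lebesgue measure: for [a > 0] the rescaled pushforward [nu] agrees with [mu] on
    half-open intervals. A negative [a] would reverse these intervals, so it is first replaced by
    [- a] through invariance under reflection. *)
Lemma lebesgue_measure_affine (a : R) (b : R) (A : set (measurableTypeR R)) :
  a != 0 -> measurable A ->
  mu [set x | A (a * x + b)] = (`|a|^-1%:E * mu A)%E.
Proof.
move=> a0 mA; wlog a_gt0 : a a0 / 0 < a => [wlog_gt0|].
  case: (ltgtP 0 a) a0 => // [a_gt0 _|a_lt0 _].
    by rewrite wlog_gt0 // gt_eqF.
  rewrite -normrN -wlog_gt0 ?oppr_eq0 ?oppr_gt0 ?lt_eqF //.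
  have mB : measurable [set x : measurableTypeR R | A (- a * x + b)].
    by rewrite -[X in measurable X]setTI; exact: (measurable_affine (- a) b).
  rewrite -(lebesgue_measureN mB).
  by congr (mu _); apply/seteqP; split => x /=; rewrite mulrNN.
rewrite gtr0_norm //.
pose f (x : measurableTypeR R) : measurableTypeR R := a * x + b.
have mf : measurable_fun setT f by exact: measurable_affine.
pose nu : {measure set (measurableTypeR R) -> \bar R} :=
  mscale (NngNum (ltW a_gt0)) (pushforward mu f).
have -> : mu A = nu mf A.
  apply: lebesgue_measure_unique => // _ [[u v] _ <-].
  transitivity (a%:E * mu (`](u - b) / a, (v - b) / a]%classic%R : set R))%E.
    rewrite !lebesgue_measure_itv /= !lte_fin ltr_pM2r ?invr_gt0 //.
    rewrite ltrD2r; case: ifP => // _; last by rewrite mule0.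
    by rewrite -!EFinB -EFinM; congr (_%:E); field; rewrite gt_eqF.
  rewrite /nu /= /mscale /pushforward /=; congr (_ * mu _)%E.
  apply/seteqP; split => x /=;
    by rewrite !in_itv /= ltr_pdivrMr // ler_pdivlMr // ltrBlDr lerBrDr mulrC.
by rewrite /nu /= /mscale /= muleA -EFinM mulVf ?mul1e ?gt_eqF.
Qed.

Lemma measurable_linear2 (a b : R) : measurable_fun setT
  (fun p : RR => a * p.1 + b * p.2 : measurableTypeR R).
Proof.
by apply: measurable_funD; apply: measurable_funM.
Qed.

Lemma measurable_linear_map (a b c d : R) : measurable_fun setT
  (fun p : RR => (a * p.1 + b * p.2, c * p.1 + d * p.2) : RR).
Proof. by apply: measurable_fun_pair; exact: measurable_linear2. Qed.

Lemma measurable_linear_preimage (a b c d : R) (S : set RR) : measurable S ->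
  measurable [set p : RR | S (a * p.1 + b * p.2, c * p.1 + d * p.2)].
Proof.
by move=> mS; rewrite -[X in measurable X]setTI; exact: measurable_linear_map.
Qed.

Lemma area_swap (S : set RR) : measurable S ->
  area [set p : RR | S (p.2, p.1)] = area S.
Proof.
move=> mS; rewrite [RHS]area_xsection area_ysection //.
have := measurable_linear_preimage 0 1 1 0 mS; congr measurable.
by apply/seteqP; split => p /=; rewrite !mul0r !mul1r addr0 add0r.
Qed.

Lemma measurable_slicey (S : set RR) x : measurable S ->
  measurable [set y | S (x, y)].
Proof. by move=> mS; rewrite -xsection_set; exact: measurable_xsection. Qed.

Lemma measurable_slicex (S : set RR) y : measurable S ->
  measurable [set x | S (x, y)].
Proof. by move=> mS; rewrite -ysection_set; exact: measurable_ysection. Qed.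

Lemma measurable_area_slicex (S : set RR) : measurable S ->
  measurable_fun setT (fun y => mu [set x | S (x, y)]).
Proof.
move=> mS; rewrite (_ : (fun y => _) = mu \o ysection S).
  exact: measurable_fun_ysection.
by apply/funext => y /=; rewrite ysection_set.
Qed.

Lemma measurable_area_slicey (S : set RR) : measurable S ->
  measurable_fun setT (fun x => mu [set y | S (x, y)]).
Proof.
move=> mS; rewrite (_ : (fun x => _) = mu \o xsection S).
  exact: measurable_fun_xsection.
by apply/funext => x /=; rewrite xsection_set.
Qed.

(** For [a != 0] the map is a composition of two maps changing one variable each, since [c x + d y =
    (c / a) (a x + b y) + (D / a) y]; Tonelli and the one-dimensional rule then apply. If [a = 0],
    exchanging the rows brings [c != 0] to the front. *)
Lemma area_linear (a b c d : R) (S : set RR) :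
  a * d - b * c != 0 -> measurable S ->
  area [set p : RR | S (a * p.1 + b * p.2, c * p.1 + d * p.2)] =
  (`|a * d - b * c|^-1%:E * area S)%E.
Proof.
wlog a0 : a b c d S / a != 0 => [wlog_a|].
  have [-> D0 mS|] := eqVneq a 0; last by move=> a0; exact: wlog_a.
  have c0 : c != 0 by apply: contraNneq D0 => ->; rewrite mul0r mulr0 subrr.
  have mS' := measurable_linear_preimage 0 1 1 0 mS.
  have /= := wlog_a c d 0 b _ c0 _ mS'.
  have -> : c * b - d * 0 = - (0 * d - b * c) by ring.
  rewrite oppr_eq0 normrN => /(_ D0) e.
  rewrite (_ : area S = area [set p : RR | S (0 * p.1 + 1 * p.2, 1 * p.1 + 0 * p.2)]).
    by rewrite -e; congr (area _); apply/seteqP; split => p /=; rewrite !(mul0r, mul1r, addr0, add0r).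
  rewrite -area_swap //; congr (area _).
  by apply/seteqP; split => p /=; rewrite !(mul0r, mul1r, addr0, add0r).
move=> D0 mS; set D := a * d - b * c in D0 *.
have mT := measurable_linear_preimage a b c d mS.
(* first substitute in x at fixed y, then in y at fixed a * x + b * y *)
have Da0 : D / a != 0 by rewrite mulf_neq0 // invr_eq0.
have mS1 : measurable [set p : RR | S (p.1, (c / a) * p.1 + (D / a) * p.2)].
  have := measurable_linear_preimage 1 0 (c / a) (D / a) mS; congr measurable.
  by apply/seteqP; split => p /=; rewrite mul0r mul1r addr0.
rewrite area_ysection //.
have -> : (\int[mu]_y mu [set x | S (a * x + b * y, c * x + d * y)%R] =
  \int[mu]_y (`|a|^-1%:E * mu [set x | S (x, (c / a) * x + (D / a) * y)%R]))%E.
  apply: eq_integral => y _.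
  rewrite -(lebesgue_measure_affine (b * y) a0 (measurable_slicex y mS1)) /=.
  have e x : (c / a) * (a * x + b * y) + (D / a) * y = c * x + d * y.
    by rewrite /D; field.
  by congr (mu _); apply/seteqP; split => x /=; rewrite e.
rewrite ge0_integralZl //; last exact: (measurable_area_slicex mS1).
rewrite -(area_ysection mS1) area_xsection.
have -> : (\int[mu]_x mu [set y | S (x, c / a * x + D / a * y)%R] =
  \int[mu]_x (`|D / a|^-1%:E * mu [set y | S (x, y)]))%E.
  apply: eq_integral => x _.
  rewrite -(lebesgue_measure_affine (c / a * x) Da0 (measurable_slicey x mS)) /=.
  by congr (mu _); apply/seteqP; split => y /=; rewrite [X in S (_, X)]addrC.
rewrite ge0_integralZl //; last exact: (measurable_area_slicey mS).
rewrite -area_xsection muleA -EFinM -invfM -normrM; congr (_%:E * _)%E.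
by congr (`| _ |^-1); field.
Qed.

End PlaneMeasure.

(** * The isodiametric inequality for the octagonal norm *)

Section Octagon.
Variable R : realType.
Local Notation mu := (@lebesgue_measure R).
Local Notation RR := (measurableTypeR R * measurableTypeR R)%type.
Local Notation rt2 := (Num.sqrt 2 : R).

Lemma sqr_rt2 : rt2 * rt2 = 2.
Proof. by rewrite -expr2 sqr_sqrtr. Qed.

Lemma rt2_bounds : 7 / 5 < rt2 /\ rt2 < 3 / 2.
Proof.
have r0 : 0 <= rt2 by exact: sqrtr_ge0.
have := sqr_rt2; split; nra.
Qed.

Lemma lebesgue_measure_le_length (S : set (measurableTypeR R)) (u v l : R) :
  measurable S -> (forall x, S x -> u <= x <= v) -> v - u <= l -> 0 <= l ->
  (mu S <= l%:E)%E.
Proof.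
move=> mS Suv uvl l0.
apply: (@le_trans _ _ (mu (`[u, v]%classic : set R))).
  by apply: le_measure; rewrite ?inE.
rewrite lebesgue_measure_itv /= lte_fin; case: ifP => _.
  by rewrite -EFinB lee_fin.
by rewrite lee_fin.
Qed.

Lemma length_le_lebesgue_measure (S : set (measurableTypeR R)) (u v : R) :
  measurable S -> (forall x, u <= x <= v -> S x) -> u <= v ->
  ((v - u)%:E <= mu S)%E.
Proof.
move=> mS Suv uv.
have : (mu (`[u, v]%classic : set R) <= mu S)%E.
  by apply: le_measure; rewrite ?inE.
rewrite lebesgue_measure_itv /= lte_fin; case: ifP => // /negbT.
by rewrite -leNgt => vu _; rewrite (le_trans _ (measure_ge0 mu _)) // lee_fin; lra.
Qed.

Lemma measurable_strip (a b c h : R) :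
  measurable [set z : RR | `|a * z.1 + b * z.2 - c| <= h].
Proof.
rewrite -[X in measurable X]setTI.
have : measurable_fun setT (fun z : RR => `|a * z.1 + b * z.2 - c| : measurableTypeR R).
  apply: measurableT_comp => //; apply: measurable_funB => //.
  exact: measurable_linear2.
move=> /(_ measurableT `]-oo, h]%classic (measurable_itv _)).
by congr measurable; apply/seteqP; split => z /=; rewrite in_itv.
Qed.

(** For [p = a + b] and [q = a - b] this is the regular octagon of inradius [h]. The four centres
    are independent because a bound on the diameter confines each of the four functionals
    separately. *)
Definition octagon (h a b p q : R) : set RR :=
  [set z | [/\ `|z.1 - a| <= h, `|z.2 - b| <= h,
     `|z.1 + z.2 - p| <= rt2 * h & `|z.1 - z.2 - q| <= rt2 * h]].

Lemma measurable_octagon h a b p q : measurable (octagon h a b p q).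
Proof.
rewrite (_ : octagon h a b p q = [set z : RR | `|1 * z.1 + 0 * z.2 - a| <= h]
    `&` [set z : RR | `|0 * z.1 + 1 * z.2 - b| <= h]
    `&` [set z : RR | `|1 * z.1 + 1 * z.2 - p| <= rt2 * h]
    `&` [set z : RR | `|1 * z.1 + (-1) * z.2 - q| <= rt2 * h]).
  by do !apply: measurableI; exact: measurable_strip.
apply/seteqP; split => z; rewrite /octagon /= !mul1r !mul0r mulN1r addr0 add0r.
  by case.
by case=> -[[]].
Qed.

(** Region under the graph of an upper bound for the length of the octagon's slice at height [z.1],
    counted from the level [2 (rt2 - 1) h]. The excess [z.2] runs up to
    [2 h - 2 (rt2 - 1) h = (4 - 2 rt2) h]. *)
Definition trapezoid (h y0 : R) : set RR :=
  [set z | `|z.2 - (2 - rt2) * h| <= (2 - rt2) * h /\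
           `|z.1 - y0| <= h - z.2 / 2].

Lemma measurable_trapezoid h y0 : measurable (trapezoid h y0).
Proof.
rewrite (_ : trapezoid h y0 =
    [set z : RR | `|0 * z.1 + 1 * z.2 - (2 - rt2) * h| <= (2 - rt2) * h]
    `&` [set z : RR | 1 * z.1 + 2^-1 * z.2 <= y0 + h]
    `&` [set z : RR | (-1) * z.1 + 2^-1 * z.2 <= h - y0]).
  have half (a b c : R) : measurable [set z : RR | a * z.1 + b * z.2 <= c].
    rewrite -[X in measurable X]setTI.
    have := measurable_linear2 a b.
    move=> /(_ measurableT `]-oo, c]%classic (measurable_itv _)).
    by congr measurable; apply/seteqP; split => z /=; rewrite in_itv.
  by do !apply: measurableI => //; exact: measurable_strip.
apply/seteqP; split => z; rewrite /trapezoid /= !mul1r mul0r mulN1r add0r.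
  by case=> -> /[!ler_norml] /andP[? ?]; split; [split=> //; lra|lra].
by case=> -[-> ? ?]; split=> //; rewrite ler_norml; apply/andP; split; lra.
Qed.

Lemma integral_affine_decr (c H : R) : 0 <= H ->
  (\int[mu]_(z in `[0%R, H]) (c - z)%:E)%E = (c * H - H ^+ 2 / 2)%:E.
Proof.
rewrite le_eqVlt => /predU1P[<-|H0].
  by rewrite set_itv1 integral_set1 mulr0 expr0n /= mul0r subr0.
pose F (z : R) : R := c * z - z ^+ 2 / 2.
have dF (x : R) : is_derive x 1 F (c - x).
  rewrite /F; apply: is_derive_eq.
  by rewrite /GRing.scale /=; field.
have cF (x : R) : F z @[z --> x] --> F x.
  by apply: differentiable_continuous; apply/derivable1_diffP; exact: ex_derive.
rewrite (@continuous_FTC2 R (fun z => c - z) F 0 H H0).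
- by rewrite /F mulr0 expr0n /= mul0r subr0 sube0.
- by apply: continuous_subspaceT => x; apply: cvgB; [exact: cvg_cst|exact: cvg_id].
- split; first by move=> x _; exact: ex_derive.
  + by apply: cvg_at_right_filter; exact: cF.
  + by apply: cvg_at_left_filter; exact: cF.
- by move=> x _; rewrite derive1E; exact: derive_val.
Qed.

Lemma area_trapezoid h y0 : 0 <= h ->
  area R (trapezoid h y0) = (4 * (rt2 - 1) * h ^+ 2)%:E.
Proof.
move=> h0; have [r1 r2] := rt2_bounds.
rewrite area_ysection; last exact: measurable_trapezoid.
transitivity (\int[mu]_(z in `[0%R, ((4 - 2 * rt2) * h)%R]) (2 * h - z)%:E)%E.
  rewrite [RHS]integral_mkcond; apply: eq_integral => z _.
  rewrite patchE /=; case: ifPn.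
    rewrite inE /= in_itv /= => /andP[z0 zh].
    rewrite (_ : [set x | _] = `[y0 - (h - z / 2), y0 + (h - z / 2)]%classic).
      rewrite lebesgue_measure_itv /= lte_fin; case: ifP => [_|/negbT].
        by rewrite -EFinB; congr (_%:E); field.
      rewrite -leNgt => ?; congr (_%:E); nra.
    apply/seteqP; split => x; rewrite /trapezoid /= in_itv /= !ler_distl.
      by case.
    by move=> ->; split=> //; apply/andP; split; lra.
  rewrite notin_setE /= in_itv /= => zN.
  rewrite (_ : [set x | _] = set0) ?measure0 //.
  apply/seteqP; split => x //; rewrite /trapezoid /= !ler_distl => -[/andP[? ?] _].
  by apply: zN; apply/andP; split; lra.
rewrite integral_affine_decr; last nra.
congr (_%:E).
transitivity ((4 - 4 * rt2 + 2 * rt2 + 4 * rt2 - (rt2 * rt2) * 2 +2 * rt2 - 4)* h^+2).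
  by field.
by rewrite sqr_rt2; ring.
Qed.

(** The bound is the area of the regular octagon. A slice at height [y] has length at most
    [min(2 h, 2 rt2 h - 2 |y - y0|)], hence at most [th] plus the length of the fibre of the
    trapezoid over [y]. Integrating [th] over [|y - b| <= h] and adding the trapezoid gives
    [4 (rt2 - 1) h ^ 2] twice, whatever the centres are. *)
Lemma area_octagon_le h a b p q : 0 <= h ->
  (area R (octagon h a b p q) <= (8 * (rt2 - 1) * h ^+ 2)%:E)%E.
Proof.
move=> h0; have [r1 r2] := rt2_bounds.
(* [y0] is the height of the centre of the square cut out by the two diagonal strips. *)
set y0 := (p - q) / 2; set T := trapezoid h y0.
have mT : measurable T by exact: measurable_trapezoid.
have mO := measurable_octagon h a b p q.
rewrite area_ysection //.
(* [th] is the side length of the regular octagon of inradius [h]. *)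
set th := 2 * (rt2 - 1) * h; have th0 : 0 <= th by rewrite /th; nra.
apply: (@le_trans _ _ (\int[mu]_y (th%:E * (\1_`[(b - h)%R, (b + h)%R] y)%:E +
    mu [set z | T (y, z)]))%E); last first.
  rewrite ge0_integralD //; last 2 first.
  - by apply: measurable_funeM; apply/measurable_EFinP; exact: measurable_indic.
  - exact: (measurable_area_slicey mT).
  rewrite -area_xsection area_trapezoid // ge0_integralZl //; last first.
    by apply/measurable_EFinP; exact: measurable_indic.
  rewrite integral_indic // setIT.
  have muI : mu (`[b - h, b + h]%classic : set R) = (2 * h)%:E.
    rewrite lebesgue_measure_itv /= lte_fin; case: ifP => [_|/negbT].
      by rewrite -EFinB; congr (_%:E); ring.
    by rewrite -leNgt => ?; congr (_%:E); lra.
  rewrite [X in (_ * X + _)%E](_ : _ = (2 * h)%:E) //.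
  by rewrite -EFinM -EFinD lee_fin /th; nra.
  by move=> x _; rewrite mule_ge0 // lee_fin.
apply: ge0_le_integral => //.
- exact: (measurable_area_slicex mO).
- apply: emeasurable_funD; last exact: (measurable_area_slicey mT).
  by apply: measurable_funeM; apply/measurable_EFinP; exact: measurable_indic.
move=> y _; rewrite indicE; case: (boolP (y \in _)) => [|]; last first.
  rewrite notin_setE /= in_itv /= => yN; rewrite mule0 add0e.
  rewrite (_ : [set x | _] = set0) ?measure0 //.
  apply/seteqP; split => x //; rewrite /octagon /= !ler_distl => -[_ ? _ _].
  exact: yN.
rewrite inE /= in_itv /= => yI; rewrite mule1.
have mOy := measurable_slicex y mO; have mTy := measurable_slicey y mT.
(* [w] is the width at height [y] of the square of the diagonal strips, negative where the line
   misses it. *)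
set w := 2 * rt2 * h - 2 * `|y - y0|.
have Oyh : (mu [set x | octagon h a b p q (x, y)] <= (2 * h)%:E)%E.
  apply: (@lebesgue_measure_le_length _ (a - h) (a + h)) => //; [|lra|lra].
  by move=> x []/=; rewrite !ler_distl.
have Oyw l : 0 <= l -> w <= l -> (mu [set x | octagon h a b p q (x, y)] <= l%:E)%E.
  move=> l0 wl.
  case: (leP y0 y) => yy0.
    apply: (@lebesgue_measure_le_length _ (q + y - rt2 * h) (p - y + rt2 * h)) => //.
      move=> x []/= _ _; rewrite !ler_distl => /andP[? ?] /andP[? ?].
      by apply/andP; split; lra.
    by move: wl; rewrite /w ger0_norm ?subr_ge0 // /y0; lra.
  apply: (@lebesgue_measure_le_length _ (p - y - rt2 * h) (q + y + rt2 * h)) => //.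
    move=> x []/= _ _; rewrite !ler_distl => /andP[? ?] /andP[? ?].
    by apply/andP; split; lra.
  by move: wl; rewrite /w ltr0_norm ?subr_lt0 // /y0; lra.
have key t : 0 <= t -> t <= (4 - 2 * rt2) * h -> t <= 2 * h - 2 * `|y - y0| ->
    (t%:E <= mu [set z | T (y, z)])%E.
  move=> t0 t1 t2; rewrite -[t]subr0.
  apply: length_le_lebesgue_measure => // z /andP[z0 zt].
  by split => /=; [rewrite ler_distl; apply/andP; split|]; lra.
case: (leP w th) => wth.
  by rewrite (le_trans (Oyw _ th0 wth)) // leeDl.
have wE : w = 2 * rt2 * h - 2 * `|y - y0| by [].
have thE : th = 2 * rt2 * h - 2 * h by rewrite /th; ring.
have step l : l <= w -> th <= l -> l <= 2 * h ->
    (l%:E <= th%:E + mu [set z | T (y, z)])%E.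
  move=> lw thl lh; rewrite -[l](subrKC th) EFinD leeD2l //.
  by apply: key; lra.
case: (leP w (2 * h)) => wh.
  have w0 : 0 <= w by lra.
  exact: le_trans (Oyw w w0 (lexx _)) (step w (lexx _) (ltW wth) wh).
have th2 : th <= 2 * h by rewrite thE; nra.
by apply: (le_trans Oyh); apply: step; lra.
Qed.

End Octagon.

(** * Hausdorff measure of subsets of an octagonal plane *)

Section HausdorffLower.
Variables (R : realType) (E : lmodType R) (N : E -> R).
Local Notation RR := (measurableTypeR R * measurableTypeR R)%type.
Local Notation rt2 := (Num.sqrt 2 : R).

Lemma diameter_ge0 (A : set E) : (0 <= diameter N A)%E.
Proof. by apply: ereal_sup_ubound; left. Qed.

Lemma le_diameter (A : set E) x y : A x -> A y ->
  ((N (x - y))%:E <= diameter N A)%E.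
Proof. by move=> Ax Ay; apply: ereal_sup_ubound; right; exists x => //; exists y. Qed.

Lemma diameter_le (A : set E) (d : \bar R) : (0 <= d)%E ->
  (forall x y, A x -> A y -> ((N (x - y))%:E <= d)%E) -> (diameter N A <= d)%E.
Proof.
by move=> d0 Ad; apply: ge_ereal_sup => _ [->//|[x Ax [y Ay <-]]]; exact: Ad.
Qed.

(** On the line, a set of diameter at most [d] lies in an interval of length [d]: no loss occurs in
    passing from diameter to radius. *)
Lemma small_spread_center (B : set R) (d : R) :
  (forall x y, B x -> B y -> `|x - y| <= d) ->
  exists c, forall x, B x -> `|x - c| <= d / 2.
Proof.
move=> Bd; exists (sup B - d / 2) => x Bx.
have ubB : ubound B (x + d).
  by move=> y By; have := Bd y x By Bx; rewrite ler_distl => /andP[].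
have x_sup : x <= sup B by apply: ub_le_sup => //; exists (x + d).
have sup_x : sup B <= x + d by apply: ge_sup => //; exists x.
by rewrite ler_distl; apply/andP; split; lra.
Qed.

Section OctagonalChart.
Variable psi : RR -> E.
Hypothesis psi_octagonal : forall z w : RR,
  [/\ `|z.1 - w.1| <= N (psi z - psi w), `|z.2 - w.2| <= N (psi z - psi w),
   `|(z.1 + z.2) - (w.1 + w.2)| <= rt2 * N (psi z - psi w) &
   `|(z.1 - z.2) - (w.1 - w.2)| <= rt2 * N (psi z - psi w)].

(** Each of the four functionals varies on [F] by at most [d], or [rt2 * d] for the diagonal ones,
    so [F] lies in four strips of half-width proportional to [d / 2]. A measurable hull [U] is
    produced because [F] is arbitrary. *)
Lemma sub_octagon_diameter (F : set E) (d : R) : diameter N F = d%:E ->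
  exists U : set RR, [/\ measurable U, [set z | F (psi z)] `<=` U &
    (area R U <= (2 * (rt2 - 1) * d ^+ 2)%:E)%E].
Proof.
move=> dF; have d0 : 0 <= d by have := diameter_ge0 F; rewrite dF lee_fin.
have Nd z w : F (psi z) -> F (psi w) -> N (psi z - psi w) <= d.
  by move=> Fz Fw; rewrite -lee_fin -dF; exact: le_diameter.
have r0 : 0 <= rt2 by exact: sqrtr_ge0.
have center (f : RR -> R) (c : R) : 0 <= c ->
    (forall z w, `|f z - f w| <= c * N (psi z - psi w)) ->
    exists m, forall z, F (psi z) -> `|f z - m| <= c * (d / 2).
  move=> c0 fN.
  have [] := @small_spread_center [set f z | z in [set z | F (psi z)]] (c * d).
    move=> _ _ [z Fz <-] [w Fw <-]; apply: le_trans (fN z w) _.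
    by rewrite ler_wpM2l //; exact: Nd.
  by move=> m mP; exists m => z Fz; rewrite mulrA; apply: mP; exists z.
have [a aP] := center (fun z => z.1) 1 ler01 (fun z w =>
  ltac:(by rewrite mul1r; case: (psi_octagonal z w))).
have [b bP] := center (fun z => z.2) 1 ler01 (fun z w =>
  ltac:(by rewrite mul1r; case: (psi_octagonal z w))).
have [p pP] := center (fun z => z.1 + z.2) rt2 r0 (fun z w =>
  ltac:(by case: (psi_octagonal z w))).
have [q qP] := center (fun z => z.1 - z.2) rt2 r0 (fun z w =>
  ltac:(by case: (psi_octagonal z w))).
exists (octagon (d / 2) a b p q); split.
- exact: measurable_octagon.
- move=> z Fz; split; [have := aP z Fz|have := bP z Fz|exact: pP|exact: qP];
  by rewrite mul1r.
- apply: (le_trans (area_octagon_le _ _ _ _ _)); first by rewrite divr_ge0.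
  by rewrite lee_fin le_eqVlt; apply/orP; left; apply/eqP; field.
Qed.

(** By the isodiametric inequality each member of a cover costs [(pi / 4) d ^ 2], which is
    [pi / (8 (rt2 - 1))] times the area bound of its hull. Here [8 (rt2 - 1)] is the area of the
    regular octagon of inradius 1. *)
Lemma area_le_hausdorff2 (S : set RR) : measurable S ->
  ((pi / (8 * (rt2 - 1)))%:E * area R S <= hausdorff2 N (psi @` S))%E.
Proof.
move=> mS; have [r1 r2] := rt2_bounds R.
have pi0 : 0 <= pi :> R by exact: pi_ge0.
have r10 : 0 < rt2 - 1 by lra.
(* Every [delta] gives a lower bound; the value 1 serves to make all diameters finite. *)
apply: (@le_trans _ _ (hausdorff2_pre N 1 (psi @` S))); last first.
  by apply: ereal_sup_ubound; exists 1 => //=; exact: ltr01.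
apply: le_ereal_inf_tmp => _ [F [SF F1 ->]].
have dF i : diameter N (F i) = (fine (diameter N (F i)))%:E.
  rewrite fineK // ge0_fin_numE; last exact: diameter_ge0.
  by rewrite (le_lt_trans (F1 i)) // ltry.
have [U UP] := choice (fun i => sub_octagon_diameter (dF i)).
have mU i : measurable (U i) by case: (UP i).
have SU : S `<=` \bigcup_i U i.
  move=> z Sz; have [|i _ Fi] := SF (psi z); first by exists z.
  by exists i => //; case: (UP i) => _ FO _; exact: FO.
apply: (@le_trans _ _ ((pi / (8 * (rt2 - 1)))%:E * \sum_(0 <= i <oo) area R (U i))%E).
  rewrite lee_pmul2l ?lte_fin ?divr_gt0 ?pi_gt0 ?mulr_gt0 //.
  exact: measure_sigma_subadditive.
rewrite -nneseriesZl //; apply: lee_nneseries => [i _ _|i _].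
  by rewrite mule_ge0 // lee_fin divr_ge0 // mulr_ge0 // ltW.
case: (UP i) => _ _ Oi; rewrite dF.
apply: (@le_trans _ _ ((pi / (8 * (rt2 - 1)))%:E *
   (2 * (rt2 - 1) * fine (diameter N (F i)) ^+ 2)%:E)%E).
  by rewrite lee_pmul2l // lte_fin divr_gt0 ?pi_gt0 ?mulr_gt0.
rewrite -EFinM expe2 -!EFinM lee_fin le_eqVlt; apply/orP; left; apply/eqP.
by field; rewrite gt_eqF.
Qed.

End OctagonalChart.
End HausdorffLower.

(** * Hausdorff measure of discs in planes tiled by the unit ball *)

(* The translates of the unit ball [{M <= 1}] by the lattice
   [{(n + k a, n) | a, n integers}], of covolume [k], cover the plane; they
   tile it when the ball has area [k]. The form [Q] is the square of the
   Euclidean norm in the same coordinates. *)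
Record planar_tiling (R : realType) (M : R -> R -> R)
    (Q : measurableTypeR R * measurableTypeR R -> R) (k C : R) : Prop := {
  tiling_covolume : 0 < k <= 3;
  tiling_constant : 0 < C;
  tiling_triangle : forall p q r : R * R,
    M (p.1 - q.1) (p.2 - q.2) <= M (p.1 - r.1) (p.2 - r.2) + M (q.1 - r.1) (q.2 - r.2);
  tiling_homogeneous : forall a x y : R, 0 < a -> M (a * x) (a * y) = a * M x y;
  tiling_ball_bounded : forall x y : R, M x y <= 1 -> `|x| <= 1 /\ `|y| <= 1;
  tiling_cover : forall x y : R, exists c : int * int,
    M (x - (c.2%:~R + k * c.1%:~R)) (y - c.2%:~R) <= 1;
  tiling_form_measurable : measurable_fun setT (Q : _ -> measurableTypeR R);
  tiling_form_homogeneous : forall a x y : R, Q (a * x, a * y) = a ^+ 2 * Q (x, y);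
  tiling_form_near : forall (p q : R * R) eta, 0 < eta <= 1 ->
    Q p <= 1 -> `|p.1 - q.1| <= 4 * eta -> `|p.2 - q.2| <= 4 * eta ->
    Q q <= 1 + C * eta;
  tiling_form_le1 : forall p : R * R, `|p.1| <= 1 / 2 -> `|p.2| <= 1 / 2 -> Q p <= 1;
  tiling_disc_bounded : forall p : R * R, Q p <= 1 -> `|p.1| <= 2 /\ `|p.2| <= 2 }.

Section HausdorffUpper.
Variables (R : realType) (E : lmodType R) (N : E -> R).
Local Notation RR := (measurableTypeR R * measurableTypeR R)%type.
Local Notation mu := (@lebesgue_measure R).

(** Half-open fundamental domain of the lattice scaled by [eta]. Cells replace the tiles when areas
    are added up: they are disjoint, and their area is the covolume. *)
Definition cell (eta k : R) (c : int * int) : set RR :=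
  `[eta * (c.2%:~R + k * c.1%:~R), eta * (c.2%:~R + k * c.1%:~R) + eta * k[ `*`
  `[eta * c.2%:~R, eta * c.2%:~R + eta[.

Lemma measurable_cell eta k c : measurable (cell eta k c).
Proof. by apply: measurableX; exact: measurable_itv. Qed.

Lemma lebesgue_measure_co (u l : R) : 0 < l ->
  mu (`[u, u + l[%classic : set R) = l%:E.
Proof.
by move=> l0; rewrite lebesgue_measure_itv /= lte_fin ltrDl l0 -EFinB addrC addKr.
Qed.

Lemma area_cell eta k c : 0 < eta -> 0 < k ->
  area R (cell eta k c) = (k * eta ^+ 2)%:E.
Proof.
move=> e0 k0; rewrite [LHS]product_measure1E; [|exact: measurable_itv..].
transitivity ((eta * k)%:E * eta%:E)%E; last by rewrite -EFinM; congr (_%:E); ring.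
by congr (_ * _)%E; apply: lebesgue_measure_co; rewrite ?mulr_gt0.
Qed.

Lemma int_cell_unique (x : R) (m n : int) :
  m%:~R <= x < m%:~R + 1 -> n%:~R <= x < n%:~R + 1 -> m = n.
Proof.
move=> /andP[mx xm] /andP[nx xn].
have : (m%:~R : R) < (n + 1)%:~R by rewrite intrD; lra.
have : (n%:~R : R) < (m + 1)%:~R by rewrite intrD; lra.
by rewrite !ltr_int; lia.
Qed.

Lemma cell_disjoint eta k c c' p : 0 < eta -> 0 < k ->
  cell eta k c p -> cell eta k c' p -> c = c'.
Proof.
case: c => a n; case: c' => a' n' e0 k0.
rewrite /cell /= !in_itv /= => -[/andP[h1 h2] /andP[h3 h4]].
move=> [/andP[h5 h6] /andP[h7 h8]].
have L (b x : R) : eta * b <= x -> b <= x / eta by rewrite ler_pdivlMr // mulrC.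
have U (b x : R) : x < eta * b -> x / eta < b by rewrite ltr_pdivrMr // [b * _]mulrC.
have nn' : n = n'.
  apply: (@int_cell_unique (p.2 / eta)); apply/andP; split;
    by [apply: L | apply: U; rewrite mulrDr mulr1].
rewrite -{}nn' in h5 h6 *; congr (_, _).
have {}L (b : int) : eta * (n%:~R + k * b%:~R) <= p.1 ->
    b%:~R <= (p.1 / eta - n%:~R) / k.
  by move=> /L ?; rewrite ler_pdivlMr //; lra.
have {}U (b : int) : p.1 < eta * (n%:~R + k * b%:~R) + eta * k ->
    (p.1 / eta - n%:~R) / k < b%:~R + 1.
  by rewrite -mulrDr => /U ?; rewrite ltr_pdivrMr //; lra.
by apply: (@int_cell_unique ((p.1 / eta - n%:~R) / k)); rewrite ?L ?U.
Qed.

Section Tiling.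
Variables (phi : RR -> E) (M : R -> R -> R) (Q : RR -> R) (k C : R).
Hypothesis MQ : planar_tiling M Q k C.
Hypothesis N_phi : forall p q : RR, N (phi p - phi q) = M (p.1 - q.1) (p.2 - q.2).

Let k_bounds := tiling_covolume MQ.
Let C_gt0 := tiling_constant MQ.
Let M_sub := tiling_triangle MQ.
Let M_hom := tiling_homogeneous MQ.
Let M_le1 := tiling_ball_bounded MQ.
Let M_cover := tiling_cover MQ.
Let measurable_Q := tiling_form_measurable MQ.
Let Q_hom := tiling_form_homogeneous MQ.
Let Q_near := tiling_form_near MQ.

Let sublevel (a : R) : set RR := [set p | Q p <= a].

Lemma measurable_sublevel a : measurable (sublevel a).
Proof.
rewrite -[X in measurable X]setTI.
have := measurable_Q measurableT (measurable_itv `]-oo, a]).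
by congr measurable; apply/seteqP; split => z /=; rewrite in_itv.
Qed.

(** By homogeneity of [Q], the sublevel set is the dilation of the disc by the square root of
    [a]. *)
Lemma area_sublevel a : 0 < a -> area R (sublevel a) = (a%:E * area R (sublevel 1))%E.
Proof.
move=> a0; have s0 : 0 < (Num.sqrt a)^-1 by rewrite invr_gt0 sqrtr_gt0.
set s := (Num.sqrt a)^-1 in s0 *.
have s2 : s * s = a^-1 by rewrite -expr2 exprVn sqr_sqrtr // ltW.
have D : s * s - 0 * 0 != 0 by rewrite mul0r subr0 s2 invr_eq0 gt_eqF.
have := area_linear D (measurable_sublevel 1).
rewrite mul0r subr0 s2 gtr0_norm ?invr_gt0 // invrK => <-.
congr (area R _); apply/seteqP; split => -[x y] /=;
  rewrite !mul0r addr0 add0r /sublevel /= Q_hom expr2 s2 ler_pdivrMl // mulr1 //.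
Qed.

Lemma area_disc_gt0_lty : (0 < area R (sublevel 1) < +oo)%E.
Proof.
have area_box (h : R) : 0 < h ->
    area R (`[- h, h] `*` `[- h, h]) = (4 * h ^+ 2)%:E.
  move=> h0; rewrite [LHS]product_measure1E; [|exact: measurable_itv..].
  have muI : mu (`[- h, h]%classic : set R) = (2 * h)%:E.
    rewrite lebesgue_measure_itv /= lte_fin gtrN // -EFinB.
    by congr (_%:E); ring.
  transitivity ((2 * h)%:E * (2 * h)%:E)%E; first by congr (_ * _)%E.
  by rewrite -EFinM; congr (_%:E); ring.
have mbox (h : R) : measurable (`[- h, h] `*` `[- h, h] : set RR).
  by apply: measurableX; exact: measurable_itv.
apply/andP; split.
  apply: (@lt_le_trans _ _ (area R (`[- (1 / 2), 1 / 2] `*` `[- (1 / 2), 1 / 2]))).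
    by rewrite area_box ?lte_fin ?mulr_gt0 ?exprn_gt0.
  apply: le_measure; rewrite ?inE //; first exact: measurable_sublevel.
  move=> p [/=]; rewrite !in_itv /= => p1 p2.
  by apply: (tiling_form_le1 MQ); rewrite ler_norml.
apply: (@le_lt_trans _ _ (area R (`[- 2, 2] `*` `[- 2, 2]))); last first.
  by rewrite area_box // ltry.
apply: le_measure; rewrite ?inE //; first exact: measurable_sublevel.
move=> p /= /(tiling_disc_bounded MQ)[p1 p2].
by rewrite !in_itv /= -!ler_norml.
Qed.

Let center eta (c : int * int) : RR :=
  (eta * (c.2%:~R + k * c.1%:~R), eta * c.2%:~R).
Let tile eta c : set RR :=
  [set p | M (p.1 - (center eta c).1) (p.2 - (center eta c).2) <= eta].

Lemma tile_cover eta p : 0 < eta -> exists c, tile eta c p.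
Proof.
move=> e0; have [c cP] := M_cover (p.1 / eta) (p.2 / eta).
exists c; rewrite /tile /center /=.
have e x z : x - eta * z = eta * (x / eta - z) by field; rewrite gt_eqF.
by rewrite !e M_hom // -[leRHS]mulr1 ler_pM2l.
Qed.

(** The constant is [4 = 1 + 3]: a tile reaches at most [eta] from its lattice point in each
    coordinate, and a cell at most [3 * eta] since [k <= 3]. *)
Lemma tile_cell_near eta c p q : 0 < eta -> tile eta c p -> cell eta k c q ->
  `|p.1 - q.1| <= 4 * eta /\ `|p.2 - q.2| <= 4 * eta.
Proof.
move=> e0; rewrite /tile /cell /= !in_itv /= => Mp [/andP[h1 h2] /andP[h3 h4]].
have /andP[k0 k3] := k_bounds; have ke : eta * k <= 3 * eta by nra.
have e x z : x - eta * z = eta * ((x - eta * z) / eta) by field; rewrite gt_eqF.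
move: Mp; rewrite (e p.1) (e p.2) M_hom // -[leRHS]mulr1 ler_pM2l // => /M_le1.
rewrite !normrM !normfV !(gtr0_norm e0) !ler_pdivrMr // !mul1r.
rewrite !ler_distl => -[/andP[h5 h6] /andP[h7 h8]].
by split; apply/andP; split; lra.
Qed.

Let touches eta c := `[< exists2 p, tile eta c p & Q p <= 1 >].
(** Covers are indexed by [nat], so lattice points are enumerated by their [pickle] code; an index
    that codes no point gets the empty set, which costs nothing. *)
Let cover_set eta (i : nat) : set E :=
  if pickle_inv i is Some c then phi @` (tile eta c `&` sublevel 1) else set0.
Let cover_cell eta (i : nat) : set RR :=
  if pickle_inv i is Some c then if touches eta c then cell eta k c else set0
  else set0.

(** A tile has diameter at most [2 * eta], so it costs at most [pi * eta ^ 2], that is [pi / k]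
    times the area of its cell. The cells of the tiles that meet the disc are disjoint and stay
    within [4 * eta] of it, hence inside the sublevel set of [1 + C * eta]. *)
Lemma hausdorff2_pre_sublevel_le eta delta : 0 < eta <= 1 -> 2 * eta <= delta ->
  (hausdorff2_pre N delta (phi @` sublevel 1) <=
   (pi / k * (1 + C * eta))%:E * area R (sublevel 1))%E.
Proof.
move=> /[dup] eta1 /andP[e0 e1] ed; have /andP[k0 k3] := k_bounds.
have mcell i : measurable (cover_cell eta i).
  rewrite /cover_cell; case: pickle_inv => [c|//].
  by case: ifP => // _; exact: measurable_cell.
have diam_set i : (diameter N (cover_set eta i) <= (2 * eta)%:E)%E.
  apply: diameter_le; first by rewrite lee_fin mulr_ge0 // ltW.
  rewrite /cover_set; case: pickle_inv => [c|//] _ _ [p [tp _] <-] [q [tq _] <-].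
  rewrite lee_fin N_phi; have := M_sub p q (center eta c).
  by move: tp tq; rewrite /tile /=; lra.
have diam_cell i : ((pi / 4)%:E * diameter N (cover_set eta i) ^+ 2 <=
    (pi / k)%:E * area R (cover_cell eta i))%E.
  have [[c ci t]|i0] : (exists2 c, pickle_inv i = Some c & touches eta c) \/
      cover_set eta i = set0.
    rewrite /cover_set; case: pickle_inv => [c|]; last by right.
    case tc : (touches eta c); [by left; exists c|right].
    apply/seteqP; split => // y [p [tp Qp] _].
    by move/asboolP: tc; apply; exists p.
  - have -> : cover_cell eta i = cell eta k c.
      by rewrite /cover_cell ci t.
    rewrite area_cell // -EFinM.
    have : ((pi / 4)%:E * diameter N (cover_set eta i) ^+ 2 <=
        (pi / 4)%:E * (2 * eta)%:E ^+ 2)%E.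
      rewrite lee_pmul2l ?lte_fin ?divr_gt0 ?pi_gt0 //.
      by rewrite !expe2 lee_pmul ?diameter_ge0.
    move=> /le_trans; apply; rewrite expe2 -!EFinM lee_fin le_eqVlt.
    by apply/orP; left; apply/eqP; field; rewrite gt_eqF.
  (* This case rests on the convention that the empty set has diameter 0. *)
  - rewrite i0 (_ : diameter N set0 = 0%E).
      by rewrite expe2 !mule0 mule_ge0 // lee_fin divr_ge0 ?pi_ge0 // ltW.
    by apply/eqP; rewrite eq_le diameter_ge0 diameter_le.
have cover_sub : \bigcup_i cover_cell eta i `<=` sublevel (1 + C * eta).
  move=> q [i _]; rewrite /cover_cell; case: pickle_inv => [c|//].
  case: ifP => // /asboolP[p tp Qp] cq.
  by have [? ?] := tile_cell_near e0 tp cq; exact: (Q_near eta1 Qp).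
have triv : trivIset setT (cover_cell eta).
  move=> i j _ _ [p []]; rewrite /cover_cell.
  case ci : (pickle_inv i) => [c|//]; case: ifP => // _ cp.
  case cj : (pickle_inv j) => [c'|//]; case: ifP => // _ c'p.
  have cc' := cell_disjoint e0 k0 cp c'p.
  have := pickle_invK (T := (int * int)%type) i; have := pickle_invK (T := (int * int)%type) j.
  by rewrite ci cj cc' /= => -> .
apply: (@le_trans _ _ (\sum_(0 <= i <oo)
    ((pi / 4)%:E * diameter N (cover_set eta i) ^+ 2))%E).
  apply: ereal_inf_lbound; exists (cover_set eta); split => //.
    move=> _ [p Qp <-]; have [c tc] := tile_cover p e0.
    exists (pickle c); first exact: I.
    by rewrite /cover_set pickleK_inv; exists p.
  by move=> i; apply: (le_trans (diam_set i)); rewrite lee_fin.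
apply: (@le_trans _ _ (\sum_(0 <= i <oo) ((pi / k)%:E * area R (cover_cell eta i)))%E).
  apply: lee_nneseries => i _ //.
  by move=> _; rewrite mule_ge0 ?lee_fin ?divr_ge0 ?pi_ge0 // expe2 mule_ge0 ?diameter_ge0.
rewrite nneseriesZl // -measure_semi_bigcup //; last exact: bigcupT_measurable.
rewrite (EFinM (pi / k)) -muleA lee_pmul2l ?lte_fin ?divr_gt0 ?pi_gt0 //.
rewrite -area_sublevel; last by rewrite addr_gt0 // mulr_gt0.
apply: le_measure; rewrite ?inE //; first exact: bigcupT_measurable.
exact: measurable_sublevel.
Qed.


(** As [eta] tends to 0, the contribution of the boundary layer of cells vanishes. *)
Lemma hausdorff2_sublevel_le :
  (hausdorff2 N (phi @` sublevel 1) <= (pi / k)%:E * area R (sublevel 1))%E.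
Proof.
have /andP[_ Afin] := area_disc_gt0_lty; have /andP[k0 k3] := k_bounds.
have pk0 : 0 < pi / k :> R by rewrite divr_gt0 // pi_gt0.
apply: ge_ereal_sup => _ [delta /= d0 <-].
have [A AE] : exists A, area R (sublevel 1) = A%:E.
  by exists (fine (area R (sublevel 1))); rewrite fineK // ge0_fin_numE.
have A0 : 0 <= A by rewrite -lee_fin -AE.
rewrite AE; apply/lee_addgt0Pr => e e0.
(* The three bounds keep [eta] in the range of the estimate, the diameters below [delta], and the
   error below [e]; [A + 1] makes the denominator positive. *)
pose eta := Num.min (Num.min 1 (delta / 2)) (e / (pi / k * C * (A + 1))).
have A1 : 0 < A + 1 by lra.
have D0 : 0 < pi / k * C * (A + 1) by rewrite mulr_gt0 // mulr_gt0.
have eta0 : 0 < eta by rewrite /eta !lt_min ltr01 /= divr_gt0 // divr_gt0.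
have eta1 : eta <= 1 by rewrite /eta !ge_min lexx.
have etad : eta <= delta / 2 by rewrite /eta !ge_min lexx orbT.
have etae : eta <= e / (pi / k * C * (A + 1)) by rewrite /eta ge_min lexx orbT.
apply: (le_trans (@hausdorff2_pre_sublevel_le eta delta _ _)).
- by rewrite eta0.
- by lra.
rewrite AE -!EFinM -EFinD lee_fin.
have : pi / k * C * (A + 1) * eta <= e by rewrite mulrC -ler_pdivlMr.
have : 0 <= pi / k * C * eta by do 2 (apply: mulr_ge0; last exact: ltW); exact: ltW.
by nra.
Qed.

End Tiling.
End HausdorffUpper.

(** * The two model tilings, by squares and by hexagons *)

Section Tilings.
Variable R : realType.
Local Notation RR := (measurableTypeR R * measurableTypeR R)%type.

Lemma int_frac (x : R) : exists i : int, i%:~R <= x < i%:~R + 1.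
Proof.
exists (Num.floor x); have := floor_itv x.
by rewrite intrD.
Qed.

Definition normM2 (x y : R) : R := `|x| + `|y|.
(** The l1 norm in the basis [(b_i + b_j) / 2], [(b_j + b_k) / 2], see [sum_norm3]; its unit ball is
    a hexagon of area 3. *)
Definition normM3 (x y : R) : R := Num.max `|x| (Num.max `|y| `|x + y|).
Definition formQ2 (p : R * R) : R := p.1 ^+ 2 + p.2 ^+ 2.
(** The squared Euclidean norm in the same basis, [(x / 2) ^ 2 + ((x + y) / 2) ^ 2 + (y / 2) ^
    2]. *)
Definition formQ3 (p : R * R) : R := (p.1 ^+ 2 + p.1 * p.2 + p.2 ^+ 2) / 2.

Lemma normM3_le (x y c : R) :
  (normM3 x y <= c) = [&& `|x| <= c, `|y| <= c & `|x + y| <= c].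
Proof. by rewrite /normM3 !ge_max. Qed.

(** The lattice consists of the integer points with even coordinate difference. Every unit square
    has two opposite corners in it, and the diagonal between the other two corners splits the square
    into triangles, each within the ball around one lattice corner. *)
Lemma normM2_cover (x y : R) : exists c : int * int,
  normM2 (x - (c.2%:~R + 2 * c.1%:~R)) (y - c.2%:~R) <= 1.
Proof.
have [i /andP[ix xi]] := int_frac x; have [j /andP[jy yj]] := int_frac y.
have [q qP] : exists q : int, i = j + 2 * q \/ i = j + 2 * q + 1.
  by exists ((i - j) %/ 2)%Z; lia.
have nrm (s t u v : R) : s <= u -> - s <= u -> t <= v -> - t <= v -> u + v <= 1 ->
    normM2 s t <= 1.
  move=> su su' tv tv' uv; apply: le_trans uv.
  by rewrite /normM2 lerD // ler_norml; apply/andP; split; lra.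
case: qP => /(congr1 (fun z : int => z%:~R : R)); rewrite !intrD intrM => ijq.
- case: (leP ((x - i%:~R) + (y - j%:~R)) 1) => xy.
  + exists (q, j) => /=.
    by apply: (nrm _ _ (x - i%:~R) (y - j%:~R)); lra.
  + exists (q, j + 1) => /=; rewrite !intrD.
    by apply: (nrm _ _ (i%:~R + 1 - x) (j%:~R + 1 - y)); lra.
- case: (leP ((i%:~R + 1 - x) + (y - j%:~R)) 1) => xy.
  + exists (q + 1, j) => /=; rewrite !intrD.
    by apply: (nrm _ _ (i%:~R + 1 - x) (y - j%:~R)); lra.
  + exists (q, j + 1) => /=; rewrite !intrD.
    by apply: (nrm _ _ (x - i%:~R) (j%:~R + 1 - y)); lra.
Qed.

(** The lattice consists of the integer points whose coordinate difference is divisible by 3. A unit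
    square has either its lower left and upper right corners in it, and is split by a diagonal, or
    exactly one of the other two corners, whose ball contains the whole square. *)
Lemma normM3_cover (x y : R) : exists c : int * int,
  normM3 (x - (c.2%:~R + 3 * c.1%:~R)) (y - c.2%:~R) <= 1.
Proof.
have [i /andP[ix xi]] := int_frac x; have [j /andP[jy yj]] := int_frac y.
have [q qP] : exists q : int,
    [\/ i = j + 3 * q, i = j + 3 * q + 1 | i = j + 3 * q + 2].
  have : [\/ ((i - j) %% 3 = 0)%Z, ((i - j) %% 3 = 1)%Z | ((i - j) %% 3 = 2)%Z].
    have : (0 <= (i - j) %% 3 < 3)%Z by lia.
    by case: ((i - j) %% 3)%Z => [[|[|[|]]]|] // _; [apply: Or31|apply: Or32|apply: Or33].
  by case=> e; exists ((i - j) %/ 3)%Z; [apply: Or31|apply: Or32|apply: Or33]; lia.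
have nrm (s t : R) : -1 <= s <= 1 -> -1 <= t <= 1 -> -1 <= s + t <= 1 ->
    normM3 s t <= 1.
  by move=> s1 t1 st1; rewrite normM3_le !ler_norml s1 t1 st1.
case: qP => /(congr1 (fun z : int => z%:~R : R)); rewrite !intrD intrM => ijq.
- case: (leP ((x - i%:~R) + (y - j%:~R)) 1) => xy.
  + by exists (q, j) => /=; apply: nrm; apply/andP; split; lra.
  + exists (q, j + 1) => /=; rewrite !intrD.
    by apply: nrm; apply/andP; split; lra.
- exists (q, j + 1) => /=; rewrite !intrD.
  by apply: nrm; apply/andP; split; lra.
- exists (q + 1, j) => /=; rewrite !intrD.
  by apply: nrm; apply/andP; split; lra.
Qed.

Lemma normM2_tiling : planar_tiling normM2 formQ2 2 48.
Proof.
split.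
- by apply/andP; split; lra.
- by [].
- move=> p q r; rewrite /normM2.
  have := ler_distD r.1 p.1 q.1; have := ler_distD r.2 p.2 q.2.
  by rewrite [`|r.1 - q.1|]distrC [`|r.2 - q.2|]distrC; lra.
- by move=> a x y a0; rewrite /normM2 !normrM gtr0_norm // mulrDr.
- move=> x y; rewrite /normM2.
  by have := normr_ge0 x; have := normr_ge0 y; split; lra.
- exact: normM2_cover.
- by apply: measurable_funD; apply: measurable_funX.
- by move=> a x y; rewrite /formQ2 /= !exprMn mulrDr.
- move=> [x y] [x' y'] eta /andP[e0 e1]; rewrite /formQ2 /= => Q1.
  (* [24 = 2 * 4 + 4 ^ 2], using [eta ^ 2 <= eta]; two squares give 48. *)
  have bound (s t : R) : s ^+ 2 <= 1 -> `|s - t| <= 4 * eta ->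
      t ^+ 2 <= s ^+ 2 + 24 * eta.
    move=> s1; rewrite ler_norml => /andP[h1 h2].
    have [? ?] : - 1 <= s /\ s <= 1 by split; nra.
    by nra.
  move=> /bound /[swap] /bound b1 b2.
  have := sqr_ge0 x; have := sqr_ge0 y; move=> ? ?.
  have := b1 ltac:(lra); have := b2 ltac:(lra); lra.
- move=> [x y] /=; rewrite !ler_norml /formQ2 /= => /andP[? ?] /andP[? ?]; nra.
- move=> [x y]; rewrite /formQ2 /= => Q1.
  by rewrite !ler_norml; split; apply/andP; split; nra.
Qed.

Lemma normM3_tiling : planar_tiling normM3 formQ3 3 72.
Proof.
split.
- by apply/andP; split; lra.
- by lra.
- move=> p q r; rewrite normM3_le.
  have [] : [/\ `|p.1 - r.1| <= normM3 (p.1 - r.1) (p.2 - r.2),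
     `|p.2 - r.2| <= normM3 (p.1 - r.1) (p.2 - r.2) &
     `|(p.1 - r.1) + (p.2 - r.2)| <= normM3 (p.1 - r.1) (p.2 - r.2)].
    by apply/and3P; rewrite -normM3_le.
  have [] : [/\ `|q.1 - r.1| <= normM3 (q.1 - r.1) (q.2 - r.2),
     `|q.2 - r.2| <= normM3 (q.1 - r.1) (q.2 - r.2) &
     `|(q.1 - r.1) + (q.2 - r.2)| <= normM3 (q.1 - r.1) (q.2 - r.2)].
    by apply/and3P; rewrite -normM3_le.
  rewrite !ler_norml => /andP[? ?] /andP[? ?] /andP[? ?] /andP[? ?] /andP[? ?] /andP[? ?].
  by apply/and3P; split; apply/andP; split; lra.
- move=> a x y a0; rewrite /normM3 -mulrDr !normrM (gtr0_norm a0).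
  by rewrite !maxr_pMr // ltW.
- by move=> x y; rewrite normM3_le => /and3P[].
- exact: normM3_cover.
- apply: measurable_funM => //; apply: measurable_funD.
    apply: measurable_funD; first exact: measurable_funX.
    exact: measurable_funM.
  exact: measurable_funX.
- by move=> a x y; rewrite /formQ3 /=; field.
- move=> [x y] [x' y'] eta /andP[e0 e1]; rewrite /formQ3 /= => Q1.
  rewrite !ler_norml => /andP[? ?] /andP[? ?].
  (* [96 = 2 * 2 * 8 + 8 ^ 2]. The form is a quarter of the sum of the squares of [x], [y] and
     [x + y], whence [72 = 3 * 96 / 4]. *)
  have bound (s t : R) : s ^+ 2 <= 4 -> - (8 * eta) <= s - t <= 8 * eta ->
      t ^+ 2 <= s ^+ 2 + 96 * eta.
    move=> s1 /andP[h1 h2].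
    have [? ?] : - 2 <= s /\ s <= 2 by split; nra.
    by nra.
  have x2 : x ^+ 2 <= 4 by have := sqr_ge0 (x / 2 + y); nra.
  have y2 : y ^+ 2 <= 4 by have := sqr_ge0 (x + y / 2); nra.
  have xy2 : (x + y) ^+ 2 <= 4 by have := sqr_ge0 (x - y); nra.
  have b1 : x' ^+ 2 <= x ^+ 2 + 96 * eta by apply: bound => //; lra.
  have b2 : y' ^+ 2 <= y ^+ 2 + 96 * eta by apply: bound => //; lra.
  have b3 : (x' + y') ^+ 2 <= (x + y) ^+ 2 + 96 * eta by apply: bound => //; lra.
  lra.
- move=> [x y] /=; rewrite !ler_norml /formQ3 /= => /andP[? ?] /andP[? ?]; nra.
- move=> [x y]; rewrite /formQ3 /= => Q1.
  have := sqr_ge0 (x / 2 + y); have := sqr_ge0 (x + y / 2) => ? ?.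
  by rewrite !ler_norml; split; apply/andP; split; nra.
Qed.

End Tilings.

(** * Contractions between planes *)

Section PlaneInequality.
Variables (R : realType) (E : lmodType R) (N : E -> R).
Local Notation RR := (measurableTypeR R * measurableTypeR R)%type.
Local Notation rt2 := (Num.sqrt 2 : R).
Variables (phi psi : RR -> E) (Pi : E -> E) (a b c d : R).
Variables (M : R -> R -> R) (Q : RR -> R) (k C : R).
Hypothesis MQ : planar_tiling M Q k C.
Hypothesis N_phi : forall p q : RR, N (phi p - phi q) = M (p.1 - q.1) (p.2 - q.2).
Hypothesis psi_octagonal : forall z w : RR,
  [/\ `|z.1 - w.1| <= N (psi z - psi w), `|z.2 - w.2| <= N (psi z - psi w),
   `|(z.1 + z.2) - (w.1 + w.2)| <= rt2 * N (psi z - psi w) &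
   `|(z.1 - z.2) - (w.1 - w.2)| <= rt2 * N (psi z - psi w)].
Hypothesis Pi_phi : forall p, Pi (phi p) =
  psi (a * p.1 + b * p.2, c * p.1 + d * p.2).
Hypothesis Pi_disc : (hausdorff2 N (Pi @` (phi @` [set p | (Q p <= 1)%R])) <=
  hausdorff2 N (phi @` [set p | (Q p <= 1)%R]))%E.

(** If [A] is the area of the disc in coordinates, its image has measure at least
    [pi / (8 (rt2 - 1)) * |D| * A], while the disc has measure at most [(pi / k) * A]; both [pi] and
    [A] cancel. *)
Lemma contraction_det_le : `|a * d - b * c| * k <= 8 * (rt2 - 1).
Proof.
have [r1 r2] := rt2_bounds R; have r10 : 0 < 8 * (rt2 - 1) by lra.
have /andP[k0 _] := tiling_covolume MQ.
have [->|D0] := eqVneq (a * d - b * c) 0; first by rewrite normr0 mul0r ltW.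
set D := a * d - b * c in D0 *.
set S : set RR := [set p | Q p <= 1].
have mS : measurable S := measurable_sublevel MQ 1.
have /andP[S0 Soo] := area_disc_gt0_lty MQ.
have [A AE] : exists A, area R S = A%:E.
  by exists (fine (area R S)); rewrite fineK // ge0_fin_numE.
have A0 : 0 < A by rewrite -lte_fin -AE.
(* [T] is the image of [S], as a preimage under the inverse matrix. *)
pose T : set RR := [set w | S (d / D * w.1 + - b / D * w.2,
                              - c / D * w.1 + a / D * w.2)].
have mT : measurable T by exact: measurable_linear_preimage.
have DV : d / D * (a / D) - - b / D * (- c / D) = D^-1.
  by rewrite /D; field.
have AT : area R T = (`|D|%:E * area R S)%E.
  by rewrite area_linear ?DV ?invr_eq0 // normfV invrK.
have PiS : Pi @` (phi @` S) = psi @` T.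
  apply/seteqP; split=> [_ [_ [p Sp <-] <-]|_ [p Sp <-]].
    rewrite Pi_phi; eexists; last by reflexivity.
    rewrite /T /=; move: Sp; congr S; case: p => x y /=.
    by congr (_, _); rewrite /D; field.
  pose p' : RR := (d / D * p.1 + - b / D * p.2, - c / D * p.1 + a / D * p.2).
  exists (phi p'); first by exists p'.
  rewrite Pi_phi /=; congr psi; case: p {Sp} @p' => x y /=.
  by congr (_, _); rewrite /D; field.
have lower := area_le_hausdorff2 psi_octagonal mT.
have upper := hausdorff2_sublevel_le MQ N_phi.
have := le_trans lower (le_trans _ upper); rewrite -PiS => /(_ Pi_disc).
rewrite AT AE -!EFinM lee_fin.
have pi0 : 0 < pi :> R by exact: pi_gt0.
rewrite mulrA ler_pM2r // mulrAC ler_pdivrMr // mulrAC ler_pdivlMr // -!mulrA.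
by rewrite ler_pM2l.
Qed.

End PlaneInequality.

(** * The algebraic contradiction *)

Section FinalAlgebra.
Variable R : realType.
Local Notation rt2 := (Num.sqrt 2 : R).

Lemma pluecker_contradiction (a1 a2 a3 a4 b1 b2 b3 b4 : R) :
  let w (x y x' y' : R) := x * y' - x' * y in
  let c := 6 * rt2 - 8 in
  let w12 := w a1 b1 a2 b2 in let w13 := w a1 b1 a3 b3 in
  let w14 := w a1 b1 a4 b4 in let w23 := w a2 b2 a3 b3 in
  let w24 := w a2 b2 a4 b4 in let w34 := w a3 b3 a4 b4 in
  rt2 / 4 * (w12 + w23 + w34 + w14) + (w13 + w24) / 2 = 1 ->
  w12 <= c -> w23 <= c -> w34 <= c -> w14 <= c -> w13 <= c -> w24 <= c ->
  3 * (w12 + w23 + w13) <= 8 * c -> 3 * (w23 + w34 + w24) <= 8 * c ->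
  3 * (w34 + w14 + w13) <= 8 * c -> 3 * (w14 + w12 + w24) <= 8 * c -> False.
Proof.
move=> w c w12 w13 w14 w23 w24 w34.
have : w12 * w34 - w13 * w24 + w14 * w23 = 0.
  by rewrite /w12 /w34 /w13 /w24 /w14 /w23 /w; ring.
move: w12 w13 w14 w23 w24 w34 => p1 q1 p4 p2 q2 p3 pluecker.
have [r1 r2] := rt2_bounds R; have rr := sqr_rt2 R.
set r := rt2 in r1 r2 rr c *.
have cE : c = 6 * r - 8 by [].
clearbody c r => {w}.
have c0 : 0 < c by rewrite cE; lra.
have rc : r * c = 12 - 8 * r by rewrite cE mulrBr mulrCA rr; ring.
(* From here on the unknowns are the slacks [y_i] of the cyclically adjacent pairs and [z_i] of the
   two diagonal pairs. *)
have -> : p1 = c - (c - p1) by ring.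
have -> : p2 = c - (c - p2) by ring.
have -> : p3 = c - (c - p3) by ring.
have -> : p4 = c - (c - p4) by ring.
have -> : q1 = c - (c - q1) by ring.
have -> : q2 = c - (c - q2) by ring.
move: pluecker.
have -> : p1 * p3 - q1 * q2 + p4 * p2 =
  c * c - c * ((c - p1) + (c - p2) + (c - p3) + (c - p4)) + c * ((c - q1) + (c - q2))
  + (c - p1) * (c - p3) + (c - p2) * (c - p4) - (c - q1) * (c - q2) by ring.
move: (c - p1) (c - p2) (c - p3) (c - p4) (c - q1) (c - q2) => y1 y2 y3 y4 z1 z2.
move=> pluecker unit h1 h2 h3 h4 h5 h6 h7 h8 h9 h10.
(* The normalization times [2 r]; the constant simplifies because [4 c + 2 r c - 2 r = c]. *)
have sumy : y1 + y2 + y3 + y4 + r * (z1 + z2) = c.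
  have e : r * r * (4 * c - (y1 + y2 + y3 + y4)) / 2 + r * (2 * c - (z1 + z2)) = 2 * r.
    by have /= := congr1 (fun x => 2 * r * x) unit; rewrite mulr1 => <-; field.
  by rewrite rr in e; lra.
have {}sumy : y1 + y2 + y3 + y4 = c - r * (z1 + z2) by lra.
have y10 : 0 <= y1 by lra.
have y20 : 0 <= y2 by lra.
have y30 : 0 <= y3 by lra.
have y40 : 0 <= y4 by lra.
have z10 : 0 <= z1 by lra.
have z20 : 0 <= z2 by lra.
have rZ : z1 + z2 <= r * (z1 + z2) by rewrite ler_peMl; lra.
(* Substituted in [pluecker], this leaves [r c (z1 + z2) + c (z1 + z2) + y1 y3 + y2 y4 - z1 z2 = 0].
   Since [z2 <= c], the last term is absorbed and all the others vanish. *)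
have cy : c * (y1 + y2 + y3 + y4) = c * c - r * c * (z1 + z2) by rewrite sumy; ring.
have cZ : c * (z1 + z2) <= c * (r * (z1 + z2)) by rewrite ler_wpM2l // ltW.
have y13 : 0 <= y1 * y3 by exact: mulr_ge0.
have y24 : 0 <= y2 * y4 by exact: mulr_ge0.
have z12 : z1 * z2 <= c * z1 by rewrite mulrC ler_wpM2r //; lra.
have cz1 : 0 <= c * z1 by rewrite mulr_ge0 // ltW.
have cz2 : 0 <= c * z2 by rewrite mulr_ge0 // ltW.
have {}cz1 : c * z1 = 0 by lra.
have {}cz2 : c * z2 = 0 by lra.
have z1E : z1 = 0 by apply/eqP; have /eqP := cz1; rewrite mulf_eq0 gt_eqF.
have z2E : z2 = 0 by apply/eqP; have /eqP := cz2; rewrite mulf_eq0 gt_eqF.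
rewrite z1E z2E !(addr0, mulr0, mul0r) in sumy pluecker cy.
have {}y13 : y1 * y3 = 0 by lra.
have {}y24 : y2 * y4 = 0 by lra.
move/eqP: y13; move/eqP: y24; rewrite !mulf_eq0.
(* One of [y1], [y3] and one of [y2], [y4] vanish, so two adjacent minors and both diagonal ones
   equal [c]; some three-term inequality then reads [9 c <= 8 c]. *)
by move=> /orP[/eqP e|/eqP e] /orP[/eqP e'|/eqP e']; lra.
Qed.
End FinalAlgebra.

(** * Coordinates in which the norm is l1 *)

Lemma orthonormal_nth (R : realType) (X : vectType R) (dot : {dot X for idfun})
    (s : seq X) (i j : nat) : size s = 4 -> orthonormal dot s ->
  (i < 4)%N -> (j < 4)%N -> dot s`_i s`_j = (i == j)%:R.
Proof.
case: s => [|x0 [|x1 [|x2 [|x3 [|]]]]] //= _.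
rewrite /orthonormal /= /ortho_rec /= !andbT.
case/andP=> /and4P[/eqP d0 /eqP d1 /eqP d2 /eqP d3].
case/and3P=> /and3P[/eqP d01 /eqP d02 /eqP d03] /andP[/eqP d12 /eqP d13] /eqP d23.
have dC x y : dot x y = dot y x by rewrite hermC /= expr0 mul1r.
case: i => [|[|[|[|]]]] // _; case: j => [|[|[|[|]]]] // _ /=;
  by rewrite ?(d0, d1, d2, d3, d01, d02, d03, d12, d13, d23) // dC
    ?(d0, d1, d2, d3, d01, d02, d03, d12, d13, d23).
Qed.

Section Coordinates.
Variables (R : realType) (X : vectType R) (dot : {dot X for idfun}).
Variables (e : 4.-tuple X) (n : nat).
Hypothesis basis_e : basis_of fullv e.
Hypothesis orthonormal_e : orthonormal dot e.
Local Notation rt2 := (Num.sqrt 2 : R).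
Local Notation RR := (measurableTypeR R * measurableTypeR R)%type.
Local Notation Y := (spaceY X n).
Local Notation "e_[ i ]" := (tnth e (inord i)) (format "e_[ i ]").

Definition pt (y1 y2 y3 y4 : R) : X :=
  y1 *: e_[0] + y2 *: e_[1] + y3 *: e_[2] + y4 *: e_[3].

Lemma coord_pt y1 y2 y3 y4 :
  [/\ coord e (inord 0) (pt y1 y2 y3 y4) = y1, coord e (inord 1) (pt y1 y2 y3 y4) = y2,
      coord e (inord 2) (pt y1 y2 y3 y4) = y3 & coord e (inord 3) (pt y1 y2 y3 y4) = y4].
Proof.
have fe := basis_free basis_e.
have ce (i j : 'I_4) : coord e i (tnth e j) = (i == j)%:R.
  by rewrite (tnth_nth 0) coord_free // eq_sym.
have ij (i j : nat) : (i < 4)%N -> (j < 4)%N ->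
    (inord i == inord j :> 'I_4) = (i == j).
  by move=> i4 j4; rewrite -val_eqE /= !inordK.
by split; rewrite /pt !linearD !linearZ /= !ce !ij //=;
  rewrite /GRing.scale /= !(mulr0, mulr1, addr0, add0r).
Qed.

Lemma dot_pt y1 y2 y3 y4 : dot (pt y1 y2 y3 y4) (pt y1 y2 y3 y4) =
  y1 ^+ 2 + y2 ^+ 2 + y3 ^+ 2 + y4 ^+ 2.
Proof.
have d (i j : nat) : (i < 4)%N -> (j < 4)%N -> dot e_[i] e_[j] = (i == j)%:R.
  move=> i4 j4; rewrite !(tnth_nth 0) !inordK //.
  exact: orthonormal_nth (size_tuple e) orthonormal_e i4 j4.
rewrite /pt !(linearDl, linearDr, linearZl_LR, linearZr_LR) /= !d //=.
by rewrite /GRing.scale /= !(mulr0, mulr1, addr0, add0r) !expr2.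
Qed.

(** The vector [c1 b1 + c2 b2 + c3 b3 + c4 b4], expanded in the basis [e]. *)
Definition bvec (c1 c2 c3 c4 : R) : X :=
  pt (c1 / rt2 + (c2 - c4) / 2) (c3 / rt2 + (c2 + c4) / 2)
     (c1 / rt2 - (c2 - c4) / 2) (- c3 / rt2 + (c2 + c4) / 2).

Lemma pt_linear (s t y1 y2 y3 y4 z1 z2 z3 z4 : R) :
  s *: pt y1 y2 y3 y4 + t *: pt z1 z2 z3 z4 =
  pt (s * y1 + t * z1) (s * y2 + t * z2) (s * y3 + t * z3) (s * y4 + t * z4).
Proof.
rewrite /pt !scalerDr !scalerA !scalerDl.
by rewrite addrACA [X in X + _]addrACA [X in X + _ + _]addrACA.
Qed.

Lemma bvec_linear (s t c1 c2 c3 c4 d1 d2 d3 d4 : R) :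
  s *: bvec c1 c2 c3 c4 + t *: bvec d1 d2 d3 d4 =
  bvec (s * c1 + t * d1) (s * c2 + t * d2) (s * c3 + t * d3) (s * c4 + t * d4).
Proof.
have r0 : rt2 != 0 by rewrite gt_eqF // sqrtr_gt0.
by rewrite pt_linear /bvec; congr pt; field.
Qed.

Lemma bodyC_bvec c1 c2 c3 c4 :
  bodyC e (bvec c1 c2 c3 c4) <-> `|c1| + `|c2| + `|c3| + `|c4| <= 1.
Proof.
rewrite /bodyC /= /bvec.
have [-> -> -> ->] := coord_pt (c1 / rt2 + (c2 - c4) / 2) (c3 / rt2 + (c2 + c4) / 2)
  (c1 / rt2 - (c2 - c4) / 2) (- c3 / rt2 + (c2 + c4) / 2).
have r0 : rt2 != 0 by rewrite gt_eqF // sqrtr_gt0.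
have -> : (c1 / rt2 + (c2 - c4) / 2 + (c1 / rt2 - (c2 - c4) / 2)) / rt2 = c1.
  transitivity (c1 * 2 / (rt2 * rt2)); first by field.
  by rewrite sqr_rt2; field.
have -> : (c3 / rt2 + (c2 + c4) / 2 - (- c3 / rt2 + (c2 + c4) / 2)) / rt2 = c3.
  transitivity (c3 * 2 / (rt2 * rt2)); first by field.
  by rewrite sqr_rt2; field.
have -> : (c1 / rt2 + (c2 - c4) / 2 - (c3 / rt2 + (c2 + c4) / 2) -
  (c1 / rt2 - (c2 - c4) / 2) - (- c3 / rt2 + (c2 + c4) / 2)) / 2 = - c4 by field.
have -> : (c1 / rt2 + (c2 - c4) / 2 + (c3 / rt2 + (c2 + c4) / 2) -
  (c1 / rt2 - (c2 - c4) / 2) + (- c3 / rt2 + (c2 + c4) / 2)) / 2 = c2 by field.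
by rewrite normrN (_ : _ + _ = `|c1| + `|c2| + `|c3| + `|c4|) //; ring.
Qed.

Lemma dot_bvec c1 c2 c3 c4 : dot (bvec c1 c2 c3 c4) (bvec c1 c2 c3 c4) =
  c1 ^+ 2 + c2 ^+ 2 + c3 ^+ 2 + c4 ^+ 2.
Proof.
have r0 : rt2 != 0 by rewrite gt_eqF // sqrtr_gt0.
rewrite dot_pt.
transitivity (2 * c1 ^+ 2 / (rt2 * rt2) + c2 ^+ 2 + 2 * c3 ^+ 2 / (rt2 * rt2) + c4 ^+ 2).
  by field.
by rewrite sqr_rt2; field.
Qed.

Lemma normY_bvec c1 c2 c3 c4 :
  normY e n (bvec c1 c2 c3 c4, 0) = `|c1| + `|c2| + `|c3| + `|c4|.
Proof.
set S := _ + _; rewrite /normY /minkowski_functional.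
have S0 : 0 <= S by rewrite /S !addr_ge0.
have scale (a : R) : a *: bvec c1 c2 c3 c4 = bvec (a * c1) (a * c2) (a * c3) (a * c4).
  have := bvec_linear a 0 c1 c2 c3 c4 0 0 0 0.
  by rewrite scale0r addr0 !mul0r !addr0.
have inset (t : R) : 0 < t -> S <= t -> [set t : R | 0 < t /\ exists2 k,
    (bodyC e `*` @eucl_unit_ball R (n - 4)) k &
    ((bvec c1 c2 c3 c4, 0) : Y) = t *: k] t.
  move=> t0 St; split => //; exists (t^-1 *: (bvec c1 c2 c3 c4, 0)).
    split => /=.
      rewrite scale; apply/bodyC_bvec.
      by rewrite !normrM gtr0_norm ?invr_gt0 // -!mulrDr ler_pdivrMl // mulr1.
    rewrite scaler0 /eucl_unit_ball /= /eucl_norm big1 ?sqrtr0 // => i _.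
    by rewrite mxE expr0n.
  by rewrite scalerA divff ?scale1r // gt_eqF.
apply/eqP; rewrite eq_le; apply/andP; split.
  (* The margin [eps] covers the zero vector, for which the infimum over [t > 0] is not attained. *)
  apply/ler_addgt0Pr => eps eps0; apply: ge_inf.
    by exists 0 => t [/ltW].
  by apply: inset; lra.
apply: lb_le_inf; first by exists (S + 1); apply: inset; lra.
move=> t [t0 [[k1 k2] [/= Ck _] [ke _]]].
move: Ck; have -> : k1 = bvec (t^-1 * c1) (t^-1 * c2) (t^-1 * c3) (t^-1 * c4).
  by rewrite -scale ke scalerA mulVf ?scale1r // gt_eqF.
move/bodyC_bvec.
by rewrite !normrM gtr0_norm ?invr_gt0 // -!mulrDr ler_pdivrMl // mulr1.
Qed.

End Coordinates.

Lemma mem_span2 (R : realType) (V : vectType R) (u v w : V) :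
  w \in <<[:: u; v]>>%VS <-> exists s t, w = s *: u + t *: v.
Proof.
rewrite span_cons span_seq1; split.
  by case/memv_addP=> _ /vlineP[s ->] [_ /vlineP[t ->] ->]; exists s, t.
by move=> [s [t ->]]; apply: memv_add; apply/vlineP; [exists s|exists t].
Qed.

(** * The octagonal unit disc of the plane [span(e1, e2)] *)

Section OctagonalPlane.
Variables (R : realType) (X : vectType R) (e : 4.-tuple X) (n : nat).
Hypothesis basis_e : basis_of fullv e.
Local Notation rt2 := (Num.sqrt 2 : R).
Local Notation RR := (measurableTypeR R * measurableTypeR R)%type.
Local Notation Y := (spaceY X n).
Local Notation N := (normY e n).
Local Notation E1 := ((tnth e (inord 0), 0) : Y).
Local Notation E2 := ((tnth e (inord 1), 0) : Y).

Lemma invr_rt2 : rt2^-1 = rt2 / 2.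
Proof.
have r0 : rt2 != 0 by rewrite gt_eqF // sqrtr_gt0.
by apply: (mulfI r0); rewrite mulfV // mulrA sqr_rt2 divff.
Qed.

Lemma planeW_bvec (s t : R) : s *: E1 + t *: E2 =
  (bvec e (s / rt2) ((s + t) / 2) (t / rt2) ((t - s) / 2), 0).
Proof.
apply/eqP; rewrite xpair_eqE /= !scaler0 addr0 eqxx andbT; apply/eqP.
rewrite /bvec invr_rt2.
have h (x : R) : x * (rt2 / 2) * (rt2 / 2) = x / 2.
  by transitivity (x * (rt2 * rt2) / 4); [field|rewrite sqr_rt2; field].
have -> : s * (rt2 / 2) * (rt2 / 2) + ((s + t) / 2 - (t - s) / 2) / 2 = s.
  by rewrite h; field.
have -> : t * (rt2 / 2) * (rt2 / 2) + ((s + t) / 2 + (t - s) / 2) / 2 = t.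
  by rewrite h; field.
have -> : s * (rt2 / 2) * (rt2 / 2) - ((s + t) / 2 - (t - s) / 2) / 2 = 0.
  by rewrite h; field.
have -> : - (t * (rt2 / 2)) * (rt2 / 2) + ((s + t) / 2 + (t - s) / 2) / 2 = 0.
  by rewrite mulNr h; field.
by rewrite /pt !scale0r !addr0.
Qed.

(* The coordinates [x = (1 + 1/rt2) s + t/rt2] and [y = s/rt2 - (1 + 1/rt2) t]
   of [s e1 + t e2] turn the norm of the plane into
   [max(|x|, |y|, |x + y|/rt2, |x - y|/rt2)]. *)
Definition octagonal_chart (z : RR) : Y :=
  (((1 + rt2 / 2) * z.1 + rt2 / 2 * z.2) / (2 + rt2)) *: E1 +
  ((rt2 / 2 * z.1 - (1 + rt2 / 2) * z.2) / (2 + rt2)) *: E2.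

(** The matrix of the change of coordinates is symmetric of trace 0 and its square is [2 + rt2]
    times the identity, so it is its own inverse up to that factor. *)
Lemma octagonal_chartK (s t : R) : s *: E1 + t *: E2 =
  octagonal_chart ((1 + rt2 / 2) * s + rt2 / 2 * t, rt2 / 2 * s - (1 + rt2 / 2) * t).
Proof.
have r2 : 2 + rt2 != 0 by rewrite gt_eqF // addr_gt0 // sqrtr_gt0.
have h (x : R) : ((1 + rt2 / 2) * (1 + rt2 / 2) + (rt2 / 2) * (rt2 / 2)) * x / (2 + rt2) = x.
  transitivity ((1 + rt2 + rt2 * rt2 / 2) * x / (2 + rt2)); first by field.
  by rewrite sqr_rt2; field.
by rewrite /octagonal_chart /=; congr (_ *: _ + _ *: _);
  rewrite -[LHS]h; congr (_ / _); ring.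
Qed.

(** Each of [x], [y], [(x + y) / rt2], [(x - y) / rt2] is a signed sum of the four l1 coordinates,
    hence bounded by the l1 norm. *)
Lemma octagonal_chart_octagonal (z w : RR) :
  let d := N (octagonal_chart z - octagonal_chart w) in
  [/\ `|z.1 - w.1| <= d, `|z.2 - w.2| <= d,
   `|(z.1 + z.2) - (w.1 + w.2)| <= rt2 * d &
   `|(z.1 - z.2) - (w.1 - w.2)| <= rt2 * d].
Proof.
set x := z.1 - w.1; set y := z.2 - w.2.
have r0 : 0 < rt2 by rewrite sqrtr_gt0.
have r2 : 2 + rt2 != 0 by rewrite gt_eqF // addr_gt0 // sqrtr_gt0.
set s := ((1 + rt2 / 2) * x + rt2 / 2 * y) / (2 + rt2).
set t := (rt2 / 2 * x - (1 + rt2 / 2) * y) / (2 + rt2).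
have -> : octagonal_chart z - octagonal_chart w = s *: E1 + t *: E2.
  rewrite /octagonal_chart opprD addrACA -(scalerBl _ _ E1) -(scalerBl _ _ E2).
  by congr (_ *: _ + _ *: _); rewrite /s /t /x /y; field.
move=> d; rewrite {}/d planeW_bvec normY_bvec //.
have h (u : R) : ((1 + rt2 / 2) * (1 + rt2 / 2) + (rt2 / 2) * (rt2 / 2)) * u / (2 + rt2) = u.
  transitivity ((1 + rt2 + rt2 * rt2 / 2) * u / (2 + rt2)); first by field.
  by rewrite sqr_rt2; field.
have xE : x = (1 + rt2 / 2) * s + rt2 / 2 * t by rewrite -[LHS]h /s /t; field.
have yE : y = rt2 / 2 * s - (1 + rt2 / 2) * t by rewrite -[LHS]h /s /t; field.
clearbody s t => {h}.
have abs4 (a b c d : R) : [/\ `|a + b + c - d| <= `|a| + `|b| + `|c| + `|d|,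
   `|a - b - c - d| <= `|a| + `|b| + `|c| + `|d|,
   `|a + b - c - d| <= `|a| + `|b| + `|c| + `|d| &
   `|a + b + c + d| <= `|a| + `|b| + `|c| + `|d|].
  have := ler_norm a; have := ler_norm b; have := ler_norm c; have := ler_norm d.
  have := ler_norm (- a); have := ler_norm (- b); have := ler_norm (- c).
  have := ler_norm (- d); rewrite !normrN => ? ? ? ? ? ? ? ?.
  by split; rewrite ler_norml; apply/andP; split; lra.
have [n1 n2 n3 n4] := abs4 (s / rt2) ((s + t) / 2) (t / rt2) ((t - s) / 2).
set d := `|s / rt2| + `|(s + t) / 2| + `|t / rt2| + `|(t - s) / 2| in n1 n2 n3 n4 *.
move: n1 n2 n3 n4; rewrite invr_rt2 => n1 n2 n3 n4.
have r22 (u : R) : rt2 * (u * (rt2 / 2)) = u.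
  by transitivity (u * (rt2 * rt2) / 2); [field|rewrite sqr_rt2; field].
split.
- apply: le_trans n1; rewrite le_eqVlt; apply/orP; left; apply/eqP.
  by congr `|_|; rewrite xE; field.
- apply: le_trans n2; rewrite le_eqVlt; apply/orP; left; apply/eqP.
  by congr `|_|; rewrite yE; field.
- rewrite (_ : _ - _ = x + y); last by rewrite /x /y; ring.
  have := n3; rewrite -(ler_pM2l r0); apply: le_trans.
  rewrite -[X in X * _](gtr0_norm r0) -normrM le_eqVlt; apply/orP; left; apply/eqP.
  by congr `|_|; rewrite !(mulrDr, mulrN) !r22 xE yE; field.
- rewrite (_ : _ - _ = x - y); last by rewrite /x /y; ring.
  have := n4; rewrite -(ler_pM2l r0); apply: le_trans.
  rewrite -[X in X * _](gtr0_norm r0) -normrM le_eqVlt; apply/orP; left; apply/eqP.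
  by congr `|_|; rewrite !(mulrDr, mulrN) !r22 xE yE; field.
Qed.

End OctagonalPlane.

(** * Contractions onto the octagonal plane *)

Section ContractionPlane.
Variables (R : realType) (X : vectType R) (dot : {dot X for idfun}).
Variables (e : 4.-tuple X) (n : nat).
Hypothesis basis_e : basis_of fullv e.
Hypothesis orthonormal_e : orthonormal dot e.
Local Notation rt2 := (Num.sqrt 2 : R).
Local Notation RR := (measurableTypeR R * measurableTypeR R)%type.
Local Notation Y := (spaceY X n).
Local Notation N := (normY e n).
Local Notation E1 := ((tnth e (inord 0), 0) : Y).
Local Notation E2 := ((tnth e (inord 1), 0) : Y).

Variable Pi : 'End(Y).
Hypothesis Pi_contraction :
  hausdorff2_contraction (euclY dot n) N (planeW e n) Pi.

Lemma contraction_planeW (s t : R) : Pi (s *: E1 + t *: E2) = s *: E1 + t *: E2.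
Proof.
have [PiPi imPi _] := Pi_contraction.
have : s *: E1 + t *: E2 \in limg Pi by rewrite imPi; apply/mem_span2; exists s, t.
case/memv_imgP=> v _ ->.
by rewrite -[in RHS]PiPi comp_lfunE.
Qed.

Lemma contraction_image v : exists s t, Pi v = s *: E1 + t *: E2.
Proof.
have [_ imPi _] := Pi_contraction.
by apply/mem_span2; rewrite -/(planeW e n) -imPi memv_img // memvf.
Qed.

(** The bound [12 rt2 - 16 = 8 (rt2 - 1) / (2 + rt2)] is the area of the octagon in the coordinates
    of [e1], [e2]: the chart has determinant [- (2 + rt2)]. *)
Lemma contraction_plane (c1 c2 c3 c4 d1 d2 d3 d4 a b a' b' : R)
    (M : R -> R -> R) (Q : RR -> R) (k C : R) :
  planar_tiling M Q k C ->
  (forall s t, `|s * c1 + t * d1| + `|s * c2 + t * d2| + `|s * c3 + t * d3| +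
     `|s * c4 + t * d4| = M s t) ->
  (forall s t, (s * c1 + t * d1) ^+ 2 + (s * c2 + t * d2) ^+ 2 +
     (s * c3 + t * d3) ^+ 2 + (s * c4 + t * d4) ^+ 2 = Q (s, t)) ->
  Pi (bvec e c1 c2 c3 c4, 0) = a *: E1 + b *: E2 ->
  Pi (bvec e d1 d2 d3 d4, 0) = a' *: E1 + b' *: E2 ->
  `|a * b' - a' * b| * k <= 12 * rt2 - 16.
Proof.
move=> MQ ME QE Pic Pid.
set U1 : Y := (bvec e c1 c2 c3 c4, 0) in Pic *.
set U2 : Y := (bvec e d1 d2 d3 d4, 0) in Pid *.
pose phi (p : RR) : Y := p.1 *: U1 + p.2 *: U2.
have phiE p : phi p = (bvec e (p.1 * c1 + p.2 * d1) (p.1 * c2 + p.2 * d2)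
    (p.1 * c3 + p.2 * d3) (p.1 * c4 + p.2 * d4), 0).
  by rewrite -bvec_linear; apply/eqP; rewrite xpair_eqE /= !scaler0 addr0 !eqxx.
have N_phi (p q : RR) : N (phi p - phi q) = M (p.1 - q.1) (p.2 - q.2).
  have -> : phi p - phi q = phi (p.1 - q.1, p.2 - q.2).
    by rewrite /phi /= opprD addrACA !scalerBl.
  by rewrite phiE normY_bvec // ME.
have eucl_phi p : euclY dot n (phi p) = Num.sqrt (Q p).
  rewrite phiE /euclY /= (dot_bvec orthonormal_e) QE -surjective_pairing.
  rewrite /eucl_norm big1 ?sqrtr0 ?expr0n ?addr0 // => i _.
  by rewrite mxE expr0n.
have Q0 p : phi p = 0 -> p = (0, 0).
  move=> p0; have Qp : Q p = 0.
    have := dot_bvec orthonormal_e (p.1 * c1 + p.2 * d1) (p.1 * c2 + p.2 * d2)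
      (p.1 * c3 + p.2 * d3) (p.1 * c4 + p.2 * d4).
    have [-> _] : (bvec e (p.1 * c1 + p.2 * d1) (p.1 * c2 + p.2 * d2)
      (p.1 * c3 + p.2 * d3) (p.1 * c4 + p.2 * d4) : X) = 0 /\ True.
      by split=> //; have := phiE p; rewrite p0 => -[<-].
    by rewrite linear0l QE -surjective_pairing.
  (* If [Q p = 0], the whole line through [p] lies in the disc, which is bounded by 2; the multiple
     by [3 / p.1] or [3 / p.2] reaches 3. *)
  have big (u : R) : `|u * p.1| <= 2 /\ `|u * p.2| <= 2.
    apply: (tiling_disc_bounded MQ (p := (u * p.1, u * p.2))).
    by rewrite (tiling_form_homogeneous MQ) -surjective_pairing Qp mulr0.
  rewrite [p]surjective_pairing; congr (_, _); apply/eqP; apply: contraT => x0.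
    have [+ _] := big (3 / p.1); rewrite divfK // ger0_norm //; lra.
  have [_] := big (3 / p.2); rewrite divfK // ger0_norm //; lra.
pose V := <<[:: U1; U2]>>%VS.
have dimV : \dim V = 2%N.
  have : free [:: U1; U2].
    rewrite free_cons span_seq1 seq1_free; apply/andP; split.
      apply/negP => /vlineP[t tU]; have := Q0 (1, - t).
      by rewrite /phi /= tU scale1r scaleNr subrr => /(_ erefl) [] /eqP; rewrite oner_eq0.
    apply/eqP => U0; have := Q0 (0, 1).
    by rewrite /phi /= scale0r add0r scale1r => /(_ U0) [] /eqP; rewrite oner_eq0.
  by move/eqP.
have discE : phi @` [set p | Q p <= 1] = [set v | v \in V /\ euclY dot n (v - 0) <= 1].
  have sqrt_le1 p : (Num.sqrt (Q p) <= 1) = (Q p <= 1).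
    by rewrite -[X in _ <= X]sqrtr1 ler_sqrt.
  apply/seteqP; split=> [_ [p Qp <-]|v [/mem_span2[s [t ->]]]] /=; rewrite subr0.
    split; last by rewrite eucl_phi sqrt_le1.
    by apply/mem_span2; exists p.1, p.2.
  by rewrite -[_ + _]/(phi (s, t)) eucl_phi sqrt_le1; exists (s, t).
have [_ _ Hcontr] := Pi_contraction.
have {Hcontr} := Hcontr V dimV (phi @` [set p | Q p <= 1]).
have disc : euclidean_disc (euclY dot n) V (phi @` [set p | Q p <= 1]).
  by exists 0, 1; split => //; exact: mem0v.
move=> /(_ disc) Pi_disc.
have Pi_phi p : Pi (phi p) = octagonal_chart e n
   ((((1 + rt2 / 2) * a + rt2 / 2 * b)) * p.1 + ((1 + rt2 / 2) * a' + rt2 / 2 * b') * p.2,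
    (rt2 / 2 * a - (1 + rt2 / 2) * b) * p.1 + (rt2 / 2 * a' - (1 + rt2 / 2) * b') * p.2).
  have -> : Pi (phi p) = (p.1 * a + p.2 * a') *: E1 + (p.1 * b + p.2 * b') *: E2.
    by rewrite /phi linearD !linearZ /= Pic Pid !scalerDr !scalerA addrACA -!scalerDl.
  by rewrite octagonal_chartK; congr octagonal_chart; congr (_, _); ring.
have := contraction_det_le MQ N_phi (octagonal_chart_octagonal n basis_e) Pi_phi Pi_disc.
have -> : ((1 + rt2 / 2) * a + rt2 / 2 * b) * (rt2 / 2 * a' - (1 + rt2 / 2) * b') -
   ((1 + rt2 / 2) * a' + rt2 / 2 * b') * (rt2 / 2 * a - (1 + rt2 / 2) * b) =
   - ((2 + rt2) * (a * b' - a' * b)).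
  transitivity (- ((1 + rt2 + rt2 * rt2 / 2) * (a * b' - a' * b))); first by field.
  by rewrite sqr_rt2; field.
have [r1 r2] := rt2_bounds R; have rr := sqr_rt2 R.
rewrite normrN normrM gtr0_norm; last by lra.
rewrite -mulrA; move: (_ * k) => w wle.
have r20 : 0 <= 2 - rt2 by lra.
(* Multiplying by [2 - rt2] rationalizes, as [(2 + rt2) (2 - rt2) = 2]. *)
have := ler_wpM2r r20 wle; have -> : (2 + rt2) * w * (2 - rt2) = (4 - rt2 * rt2) * w by ring.
have -> : 8 * (rt2 - 1) * (2 - rt2) = 24 * rt2 - 16 - 8 * (rt2 * rt2) by ring.
by rewrite rr; lra.
Qed.

End ContractionPlane.

(** Among three numbers with sum 0, the largest absolute value is the sum of the other two; apply
    this to [s], [t] and [- (s + t)]. *)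
Lemma sum_norm3 (R : realType) (s t : R) : (`|s| + `|t| + `|s + t|) / 2 = normM3 s t.
Proof.
apply/eqP; rewrite eq_le; apply/andP; split.
  have /and3P[h1 h2 h3] : [&& `|s| <= normM3 s t, `|t| <= normM3 s t &
      `|s + t| <= normM3 s t] by rewrite -normM3_le.
  move: h1 h2 h3; rewrite !ler_norml => /andP[? ?] /andP[? ?] /andP[? ?].
  by case: (ger0P s) => ?; case: (ger0P t) => ?; case: (ger0P (s + t)) => ?; lra.
rewrite normM3_le; apply/and3P.
by split; case: (ger0P s) => ?; case: (ger0P t) => ?; case: (ger0P (s + t)) => ?; lra.
Qed.

(** * Collecting the determinant inequalities *)

Theorem proposition4 (R : realType) (X : vectType R)
    (dot : {dot X for idfun}) (e : 4.-tuple X) (n : nat)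
    (dimX : dim X = 4%N)
    (basis_e : basis_of fullv e) (orthonormal_e : orthonormal dot e)
    (n_gt4 : (4 < n)%N) :
  ~ exists Pi : 'End(spaceY X n),
      hausdorff2_contraction (euclY dot n) (normY e n) (planeW e n) Pi.
Proof.
case=> Pi Pi_contraction.
have [a1 [b1 P1]] := contraction_image Pi_contraction (bvec e 1 0 0 0, 0).
have [a2 [b2 P2]] := contraction_image Pi_contraction (bvec e 0 1 0 0, 0).
have [a3 [b3 P3]] := contraction_image Pi_contraction (bvec e 0 0 1 0, 0).
have [a4 [b4 P4]] := contraction_image Pi_contraction (bvec e 0 0 0 1, 0).
set E1 : spaceY X n := (tnth e (inord 0), 0) in P1 P2 P3 P4.
set E2 : spaceY X n := (tnth e (inord 1), 0) in P1 P2 P3 P4.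
have P c1 c2 c3 c4 : Pi (bvec e c1 c2 c3 c4, 0) =
    (c1 * a1 + c2 * a2 + c3 * a3 + c4 * a4) *: E1 +
    (c1 * b1 + c2 * b2 + c3 * b3 + c4 * b4) *: E2.
  have -> : (bvec e c1 c2 c3 c4, 0) = c1 *: (bvec e 1 0 0 0, 0) + c2 *: (bvec e 0 1 0 0, 0)
      + c3 *: (bvec e 0 0 1 0, 0) + c4 *: (bvec e 0 0 0 1, 0) :> spaceY X n.
    apply/eqP; rewrite xpair_eqE /= !scaler0 !addr0 eqxx andbT; apply/eqP.
    rewrite bvec_linear -[X in X + _ + _]scale1r bvec_linear.
    rewrite -[X in X + _]scale1r bvec_linear.
    by rewrite !(mulr0, mulr1, mul1r, addr0, add0r).
  rewrite !linearD !linearZ /= P1 P2 P3 P4 !scalerDr !scalerA.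
  have comb (x y x' y' : R) : x *: E1 + y *: E2 + (x' *: E1 + y' *: E2) =
      (x + x') *: E1 + (y + y') *: E2 by rewrite addrACA -!scalerDl.
  by rewrite !comb.
(* [Pi] is the identity on the plane; its action on [s e1 + t e2] is read off in the basis [b_i]. *)
have fix_plane s t : s / Num.sqrt 2 * a1 + (s + t) / 2 * a2 + t / Num.sqrt 2 * a3 +
      (t - s) / 2 * a4 = s /\
    s / Num.sqrt 2 * b1 + (s + t) / 2 * b2 + t / Num.sqrt 2 * b3 + (t - s) / 2 * b4 = t.
  have := contraction_planeW Pi_contraction s t.
  rewrite {1}planeW_bvec P => /(congr1 fst) /=.
  have ptE (x y : R) : x *: tnth e (inord 0) + y *: tnth e (inord 1) = pt e x y 0 0.
    by rewrite /pt !scale0r !addr0.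
  rewrite !ptE => eq_pt.
  have [c0 c1 _ _] := coord_pt basis_e s t 0 0.
  have [c0' c1' _ _] := coord_pt basis_e
    (s / Num.sqrt 2 * a1 + (s + t) / 2 * a2 + t / Num.sqrt 2 * a3 + (t - s) / 2 * a4)
    (s / Num.sqrt 2 * b1 + (s + t) / 2 * b2 + t / Num.sqrt 2 * b3 + (t - s) / 2 * b4) 0 0.
  by split; [rewrite -[LHS]c0' eq_pt c0 | rewrite -[LHS]c1' eq_pt c1].
have ineq2 c1 c2 c3 c4 d1 d2 d3 d4 M2E Q2E := contraction_plane basis_e orthonormal_e
  Pi_contraction (normM2_tiling R) M2E Q2E (P c1 c2 c3 c4) (P d1 d2 d3 d4).
have ineq3 c1 c2 c3 c4 d1 d2 d3 d4 M3E Q3E := contraction_plane basis_e orthonormal_e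
  Pi_contraction (normM3_tiling R) M3E Q3E (P c1 c2 c3 c4) (P d1 d2 d3 d4).
have le2 (x z : R) : `|x| * 2 <= 12 * Num.sqrt 2 - 16 -> x = z ->
    z <= 6 * Num.sqrt 2 - 8.
  by move=> xle <-; have := ler_norm x; lra.
have le3 (x z : R) : `|x| * 3 <= 12 * Num.sqrt 2 - 16 -> 4 * x = z ->
    3 * z <= 8 * (6 * Num.sqrt 2 - 8).
  by move=> xle <-; have := ler_norm x; lra.
have M2 (x y : R) : `|x| + `|y| = normM2 x y by [].
have Q2 (x y : R) : x ^+ 2 + y ^+ 2 = formQ2 (x, y) by [].
have Q3 (x y : R) : (x / 2) ^+ 2 + ((x + y) / 2) ^+ 2 + (y / 2) ^+ 2 = formQ3 (x, y).
  by rewrite /formQ3 /=; field.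
have M3 (x y : R) : `|x / 2| + `|(x + y) / 2| + `|y / 2| = normM3 x y.
  by rewrite -sum_norm3 !normrM !(@ger0_norm _ 2^-1) // -!mulrDl addrAC.
have sq0 : (0 : R) ^+ 2 = 0 by rewrite expr0n.
have simp := (mulr0, mulr1, mul0r, addr0, add0r, normr0, sq0).
have half (x : R) : x * (1 / 2) = x / 2 by rewrite mul1r.
have Nhalf (x : R) : x * - (1 / 2) = - (x / 2) by rewrite mulrN mul1r.
have half2 (x y : R) : x / 2 + y / 2 = (x + y) / 2 by rewrite mulrDl.
have Nhalf2 (x y : R) : - (x / 2) - y / 2 = - ((x + y) / 2) by rewrite -half2 opprD.
have simp3 := (simp, half, Nhalf, half2, Nhalf2, normrN, sqrrN).
apply: (@pluecker_contradiction R a1 a2 a3 a4 b1 b2 b3 b4) => /=.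
(* Cauchy-Binet for the determinant 1 of [Pi] on the plane: the weights [rt2 / 4] and [1 / 2] are
   the minors of the coordinates of [e1], [e2] in the basis [b_i]. *)
- have [f1 g1] := fix_plane 1 0; have [f2 g2] := fix_plane 0 1.
  set A1 := (X in X = 1) in f1; set B1 := (X in X = 0) in g1.
  set A2 := (X in X = 0) in f2; set B2 := (X in X = 1) in g2.
  have unit : A1 * B2 - A2 * B1 = 1 by rewrite f1 f2 g1 g2; ring.
  rewrite -[RHS]unit /A1 /B1 /A2 /B2 !invr_rt2.
  transitivity (Num.sqrt 2 / 4 * (a1 * b2 - a2 * b1 + (a2 * b3 - a3 * b2) +
    (a3 * b4 - a4 * b3) + (a1 * b4 - a4 * b1)) +
    (Num.sqrt 2 * Num.sqrt 2 / 2 * (a1 * b3 - a3 * b1) + (a2 * b4 - a4 * b2)) / 2).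
    by rewrite sqr_rt2; field.
  by field.
- apply: le2 (ineq2 1 0 0 0 0 1 0 0 _ _) _ => [x y|x y|].
  + by rewrite !simp M2.
  + by rewrite !simp Q2.
  + by rewrite !(mul0r, mul1r, addr0, add0r).
- apply: le2 (ineq2 0 1 0 0 0 0 1 0 _ _) _ => [x y|x y|].
  + by rewrite !simp M2.
  + by rewrite !simp Q2.
  + by rewrite !(mul0r, mul1r, addr0, add0r).
- apply: le2 (ineq2 0 0 1 0 0 0 0 1 _ _) _ => [x y|x y|].
  + by rewrite !simp M2.
  + by rewrite !simp Q2.
  + by rewrite !(mul0r, mul1r, addr0, add0r).
- apply: le2 (ineq2 1 0 0 0 0 0 0 1 _ _) _ => [x y|x y|].
  + by rewrite !simp M2.
  + by rewrite !simp Q2.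
  + by rewrite !(mul0r, mul1r, addr0, add0r).
- apply: le2 (ineq2 1 0 0 0 0 0 1 0 _ _) _ => [x y|x y|].
  + by rewrite !simp M2.
  + by rewrite !simp Q2.
  + by rewrite !(mul0r, mul1r, addr0, add0r).
- apply: le2 (ineq2 0 1 0 0 0 0 0 1 _ _) _ => [x y|x y|].
  + by rewrite !simp M2.
  + by rewrite !simp Q2.
  + by rewrite !(mul0r, mul1r, addr0, add0r).
(* Halving [b_i + b_j] and [b_j + b_k] gives them norm 1; the determinant is then a quarter of
   [w_ij + w_jk + w_ik]. *)
- apply: le3 (ineq3 (1 / 2) (1 / 2) 0 0 0 (1 / 2) (1 / 2) 0 _ _) _ => [x y|x y|].
  + by rewrite !simp3 -M3; ring.
  + by rewrite !simp3 -Q3; ring.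
  + by field.
- apply: le3 (ineq3 0 (1 / 2) (1 / 2) 0 0 0 (1 / 2) (1 / 2) _ _) _ => [x y|x y|].
  + by rewrite !simp3 -M3; ring.
  + by rewrite !simp3 -Q3; ring.
  + by field.
- apply: le3 (ineq3 0 0 (1 / 2) (1 / 2) (- (1 / 2)) 0 0 (1 / 2) _ _) _ => [x y|x y|].
  + by rewrite !simp3 -M3; ring.
  + by rewrite !simp3 -Q3; ring.
  + by field.
(* The triple is [b4], [- b1], [- b2]; the signs turn its determinants into [w14], [w12] and
   [w24]. *)
- apply: le3 (ineq3 (- (1 / 2)) 0 0 (1 / 2) (- (1 / 2)) (- (1 / 2)) 0 0 _ _) _ => [x y|x y|].
  + by rewrite !simp3 -M3; ring.
  + by rewrite !simp3 -Q3; ring.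
  + by field.
Qed.
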